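(* Let $(p_j)_{j\in\mathbb{N}}$ be a sequence of polynomials with $p_j\in\mathcal{P}_{d_j}(\mathbb{R})$, where $d_j\to\infty$ as $j\to\infty$, such that $\mu[p_j]\to\mu$ weakly for some Borel probability measure $\mu$ on $\mathbb{R}$. Let $(k_j)_{j\in\mathbb{N}}$ be a sequence of integers with $1\le k_j\le d_j$ and $\lim_{j\to\infty}k_j/d_j=t\in(0,1)$. Then $$\mu\big[\partial_{k_j|d_j}\,p_j\big]\to \mathrm{Dil}_t\big(\mu^{\boxplus 1/t}\big)\quad\text{weakly as } j\to\infty.$$
   Context: $\mathcal{P}_d(\mathbb{R})$ is the set of monic polynomials of degree $d$ with only real roots. For a monic polynomial $p$ of degree $d$ with roots $\lambda_1,\dots,\lambda_d$ (with multiplicity), $\mu[p]:=\frac1d\sum_{i=1}^d\delta_{\lambda_i}$. For $k\le d$, $\partial_{k|d}\,p:=\frac{p^{(d-k)}}{d(d-1)\cdots(k+1)}$, i.e. the $(d-k)$-th derivative of $p$ normalized to be monic of degree $k$. $\mathrm{Dil}_c\nu$ denotes the push-forward of $\nu$ under $x\mapsto cx$. For a probability measure $\mu$ on $\mathbb{R}$, let $G_\mu(z)=\int\frac{1}{z-x}\mu(dx)$ be its Cauchy transform, and let $R_\mu(z)=K_\mu(z)-1/z$, where $K_\mu$ is the compositional inverse of $G_\mu$ (defined for $z$ in the image under $G_\mu$ of a neighbourhood of infinity, i.e. of a truncated cone $\{z=x+iy: |x|<\alpha y,\ y>\beta\}$). For $s\ge 1$, $\mu^{\boxplus s}$ denotes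 the fractional free additive convolution power, i.e. the unique probability measure on $\mathbb{R}$ with $R_{\mu^{\boxplus s}}(z)=s\,R_\mu(z)$ on a common domain; for compactly supported $\mu$ it is the measure whose free cumulants are $s$ times those of $\mu$. *)

(* Defs.v *)
From HB Require Import structures.
From mathcomp Require Import all_boot all_order all_algebra.
From mathcomp Require Import all_classical all_reals all_analysis.
From mathcomp Require Import measurable_realfun complex.

Set Implicit Arguments.
Unset Strict Implicit.
Unset Printing Implicit Defensive.

Import Order.TTheory GRing.Theory Num.Theory.
Import numFieldNormedType.Exports.

Local Open Scope classical_set_scope.
Local Open Scope ring_scope.
Local Open Scope complex_scope.

Section Polynomials.
Context {R : realType}.

Definition real_rooted_monic (d : nat) (p : {poly R}) : Prop :=
  [/\ p \is monic, size p = d.+1 &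
      forall z : R[i],
        root (map_poly (fun x : R => x%:C) p) z -> complex.Im z = 0].

(* An enumeration of the roots with multiplicity, unique up to permutation
   when p is monic and splits over R; [::] if there is none. *)
Definition root_seq (p : {poly R}) : seq R :=
  xget [::] [set s : seq R | p = \prod_(r <- s) ('X - r%:P)].

Definition root_measure (p : {poly R}) :
    {measure set (measurableTypeR R) -> \bar R} :=
  let d := (size p).-1 in
  mscale ((d%:R : R)^-1)%:nng
    (msum (fun i => \d_((root_seq p)`_i : measurableTypeR R)) d).

Definition monic_deriv (k d : nat) (p : {poly R}) : {poly R} :=
  (\prod_(k.+1 <= i < d.+1) i%:R)^-1 *: p^`(d - k).

End Polynomials.

Section Measures.
Context {R : realType}.

Definition weak_cvg (mu_ : {measure set (measurableTypeR R) -> \bar R}^nat)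
    (mu : {measure set (measurableTypeR R) -> \bar R}) : Prop :=
  forall f : R -> R, continuous f -> bounded_fun f ->
    (\int[mu_ j]_x (f x)%:E)%E @[j --> \oo] --> (\int[mu]_x (f x)%:E)%E.

Definition dilation (c : R) : measurableTypeR R -> measurableTypeR R :=
  fun x => c * x.

Lemma measurable_dilation c : measurable_fun setT (dilation c).
Proof. exact: mulrl_measurable. Qed.

HB.instance Definition _ c :=
  isMeasurableFun.Build _ _ _ _ (dilation c) (measurable_dilation c).

Definition Dil (c : R) (nu : probability (measurableTypeR R) R) :
    probability (measurableTypeR R) R :=
  distribution nu (dilation c).

End Measures.

Section FreeConvolution.
Context {R : realType}.
Implicit Types mu nu : probability (measurableTypeR R) R.

Definition cauchy_transform mu (z : R[i]) : R[i] :=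
  (\int[mu]_x complex.Re ((z - (x : R)%:C)^-1)) +i*
  (\int[mu]_x complex.Im ((z - (x : R)%:C)^-1)).

Definition truncated_cone (a b : R) : set R[i] :=
  [set z | `|complex.Re z| < a * complex.Im z /\ b < complex.Im z].

(* Meaningful at w in the image of the cone, when the Cauchy transform is
   injective on the cone; 'pinv_ returns 0 outside that image. *)
Definition K_transform (a b : R) mu : R[i] -> R[i] :=
  'pinv_(fun=> 0) (truncated_cone a b) (cauchy_transform mu).

Definition R_transform (a b : R) mu (w : R[i]) : R[i] :=
  K_transform a b mu w - w^-1.

(* The two R-transforms are compared on the reciprocal of a truncated cone, a
   region accumulating at 0.  For a' < a and b' large it lies in the domain of
   the R-transform of every given probability measure, so two relations of this
   kind are always tested on a common region, whatever the cones involved. *)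
Definition is_free_conv_power (s : R) mu nu : Prop :=
  exists a b : R,
    [/\ 0 < a, 0 < b,
        set_inj (truncated_cone a b) (cauchy_transform mu),
        set_inj (truncated_cone a b) (cauchy_transform nu) &
        exists a' b' : R,
          [/\ 0 < a', 0 < b' &
            forall w : R[i], truncated_cone a' b' w^-1 ->
              [/\ (cauchy_transform mu @` truncated_cone a b) w,
                  (cauchy_transform nu @` truncated_cone a b) w &
                  R_transform a b nu w = s%:C * R_transform a b mu w]]].

(* For s >= 1 the measure exists and is unique (Nica and Speicher, Belinschi and
   Bercovici), so the default value of xget is irrelevant. *)
Definition free_conv_power (s : R) mu : probability (measurableTypeR R) R :=
  xget point [set nu | is_free_conv_power s mu nu].

End FreeConvolution.

(* Main.v *)
(* Let L_m be the logarithmic derivative of the m-th derivative of p_j, so that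
   L_(m+1) = L_m + L_m' / L_m.  A Newton step z |-> z - 1 / L_m(z) cancels the
   first-order change, and d_j - k_j such steps started at z transport the value
   of L_0 / d_j along a straight line of the upper half-plane, up to O(1 / d_j).
   With s = 1 / t and F = 1 / G_mu, this gives
     G_(nu_j)(t H(z)) -> s G_mu(z),  where H(z) = s z - (s - 1) F(z),
   for nu_j the root measure of the derivative and z high enough in a cone.
   There F and H are small Lipschitz perturbations of the identity, hence
   invertible by contraction, and G_nu(H(z)) = G_mu(z) is equivalent to
   R_nu = s R_mu.
   Convergence of the Cauchy transforms on a half-line of the imaginary axis
   determines weak limits: partial fractions with poles on the half-line
   approximate 1 / (z - x) uniformly for every z of the upper half-plane, Riemann
   sums of Poisson kernels then give arctangents and hence all functions with
   compact support.  The limit functional is represented by a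
   Lebesgue-Stieltjes measure, which proves the existence of the free
   convolution power along the way. *)

Require Import Defs.
From HB Require Import structures.
From mathcomp Require Import all_boot all_order all_algebra.
From mathcomp Require Import all_classical all_reals all_analysis.
From mathcomp Require Import measurable_realfun complex ring lra.
Import Order.TTheory GRing.Theory Num.Theory.
Import numFieldNormedType.Exports.
Local Open Scope classical_set_scope.
Local Open Scope ring_scope.

Set Implicit Arguments.
Unset Strict Implicit.
Unset Printing Implicit Defensive.

(** No moment of mu is assumed, so all control of [G_mu] comes from tightness and is uniform only
    inside truncated cones; hence the constant trading of apertures and heights. The line is
    straight because L is almost conserved, so every Newton step is almost the same vector -1 / L_0.
    One step costs O(1 / d) in L, which is itself of order d; up to d steps therefore cost O(1) in
    L. Averages over roots, integrals and the limit functional are handled as one kind of object, a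
    positive normalized functional on bounded continuous functions, so that the limit can be studied
    before any measure represents it. Existence of the convolution power cannot be bypassed: the
    chosen power satisfies its relation only once some measure does, and uniqueness then ties it to
    the limit. *)

Section ComplexModulus.
Context {R : rcfType}.
Local Open Scope complex_scope.
Implicit Types (z w : R[i]) (x : R).

Lemma normc_ge0 z : 0 <= Normc.normc z.
Proof. by case: z => a b; exact: sqrtr_ge0. Qed.

Lemma normcB z w : Normc.normc (z - w) <= Normc.normc z + Normc.normc w.
Proof. by rewrite (le_trans (le_normcD _ _))// normcN. Qed.

Lemma normc_distC z w : Normc.normc (z - w) = Normc.normc (w - z).
Proof. by rewrite -normcN opprB. Qed.

Lemma normc_triangle z w u :
  Normc.normc (z - w) <= Normc.normc (z - u) + Normc.normc (u - w).
Proof. by apply: le_trans (le_normcD _ _); rewrite addrA subrK. Qed.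

Lemma normc_real x : Normc.normc x%:C = `|x|.
Proof. by rewrite /= expr0n/= addr0 sqrtr_sqr. Qed.

Lemma normc_gt0 z : (0 < Normc.normc z) = (z != 0).
Proof.
rewrite lt_neqAle normc_ge0 andbT eq_sym; congr negb.
by apply/eqP/eqP => [/Normc.eq0_normc//|->]; rewrite Normc.normc0.
Qed.

Lemma normc_ge_normRe z : `|complex.Re z| <= Normc.normc z.
Proof.
case: z => a b /=; rewrite -sqrtr_sqr ler_sqrt ?addr_ge0 ?sqr_ge0//.
by rewrite lerDl sqr_ge0.
Qed.

Lemma normc_ge_normIm z : `|complex.Im z| <= Normc.normc z.
Proof.
case: z => a b /=; rewrite -sqrtr_sqr ler_sqrt ?addr_ge0 ?sqr_ge0//.
by rewrite lerDr sqr_ge0.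
Qed.

Lemma normc_ge_Im z : complex.Im z <= Normc.normc z.
Proof. exact: le_trans (ler_norm _) (normc_ge_normIm z). Qed.

Lemma normc_le_Re_Im z :
  Normc.normc z <= `|complex.Re z| + `|complex.Im z|.
Proof.
case: z => a b /=.
rewrite -[leRHS]ger0_norm ?addr_ge0// -[leRHS]sqrtr_sqr ler_sqrt ?sqr_ge0//.
rewrite -(real_normK (num_real a)) -(real_normK (num_real b)).
have := normr_ge0 a; have := normr_ge0 b; nra.
Qed.

Lemma ReB z w : complex.Re (z - w) = complex.Re z - complex.Re w.
Proof. by case: z => ? ?; case: w. Qed.

Lemma ImB z w : complex.Im (z - w) = complex.Im z - complex.Im w.
Proof. by case: z => ? ?; case: w. Qed.

Lemma ReD z w : complex.Re (z + w) = complex.Re z + complex.Re w.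
Proof. by case: z => ? ?; case: w. Qed.

Lemma ImD z w : complex.Im (z + w) = complex.Im z + complex.Im w.
Proof. by case: z => ? ?; case: w. Qed.

Lemma ReM z w : complex.Re (z * w) =
  complex.Re z * complex.Re w - complex.Im z * complex.Im w.
Proof. by case: z => ? ?; case: w. Qed.

Lemma ImM z w : complex.Im (z * w) =
  complex.Re z * complex.Im w + complex.Im z * complex.Re w.
Proof. by case: z => ? ?; case: w => ? ? /=; rewrite addrC mulrC addrC. Qed.

Lemma ReZ x z : complex.Re (x%:C * z) = x * complex.Re z.
Proof. by rewrite ReM /= mul0r subr0. Qed.

Lemma ImZ x z : complex.Im (x%:C * z) = x * complex.Im z.
Proof. by rewrite ImM /= mul0r addr0. Qed.

Lemma sqr_normc_Re_Im z :
  Normc.normc z ^+ 2 = complex.Re z ^+ 2 + complex.Im z ^+ 2.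
Proof. by case: z => a b /=; rewrite sqr_sqrtr ?addr_ge0 ?sqr_ge0. Qed.

Lemma ReV z : complex.Re z^-1 = complex.Re z / Normc.normc z ^+ 2.
Proof. by rewrite sqr_normc_Re_Im; case: z. Qed.

Lemma ImV z : complex.Im z^-1 = - (complex.Im z / Normc.normc z ^+ 2).
Proof. by rewrite sqr_normc_Re_Im; case: z. Qed.

Lemma normc_sum (I : Type) (s : seq I) (f : I -> R[i]) :
  Normc.normc (\sum_(i <- s) f i) <= \sum_(i <- s) Normc.normc (f i).
Proof.
elim/big_ind2 : _ => [|z a w b za wb|//]; first by rewrite Normc.normc0.
exact: le_trans (le_normcD _ _) (lerD za wb).
Qed.

Lemma Re_sum (I : Type) (s : seq I) (f : I -> R[i]) :
  complex.Re (\sum_(i <- s) f i) = \sum_(i <- s) complex.Re (f i).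
Proof. by elim/big_rec2 : _ => // i a z _ <-; rewrite ReD. Qed.

Lemma Im_sum (I : Type) (s : seq I) (f : I -> R[i]) :
  complex.Im (\sum_(i <- s) f i) = \sum_(i <- s) complex.Im (f i).
Proof. by elim/big_rec2 : _ => // i a z _ <-; rewrite ImD. Qed.

Lemma Im_gt0_neq0 z : 0 < complex.Im z -> z != 0.
Proof. by case: z => a b /= b0; rewrite eq_complex/= negb_and (gt_eqF b0) orbT. Qed.

Lemma Im_subr_real z x : complex.Im (z - x%:C) = complex.Im z.
Proof. by rewrite ImB/= subr0. Qed.

Lemma Re_subr_real z x : complex.Re (z - x%:C) = complex.Re z - x.
Proof. by rewrite ReB. Qed.

Lemma subr_real_neq0 z x : 0 < complex.Im z -> z - x%:C != 0.
Proof. by move=> z0; apply: Im_gt0_neq0; rewrite Im_subr_real. Qed.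

Lemma normc_subr_real_ge z x : complex.Im z <= Normc.normc (z - x%:C).
Proof. by rewrite -(Im_subr_real z x); exact: normc_ge_Im. Qed.

Lemma normc_resolvent_le (e : R) z x : 0 < e -> e <= complex.Im z ->
  Normc.normc (z - x%:C)^-1 <= e^-1.
Proof.
move=> e0 ez; have z0 := lt_le_trans e0 ez.
rewrite Normc.normcV lef_pV2 ?posrE//; last first.
  exact: lt_le_trans z0 (normc_subr_real_ge _ _).
exact: le_trans ez (normc_subr_real_ge _ _).
Qed.

End ComplexModulus.

(** * Newton characteristics *)

Section NewtonCharacteristics.
Context {R : rcfType}.
Local Open Scope complex_scope.
Implicit Types (z w : R[i]) (s : seq R).
Local Notation N := Normc.normc.

Definition log_deriv s z : R[i] := \sum_(r <- s) (z - r%:C)^-1.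

Lemma ler_sum_size (T : Type) (s : seq T) (f : T -> R) (c : R) :
  (forall x, f x <= c) -> \sum_(x <- s) f x <= (size s)%:R * c.
Proof.
move=> fc; elim: s => [|x s IH]; first by rewrite big_nil mul0r.
by rewrite big_cons /= -natr1 mulrDl mul1r addrC lerD.
Qed.

Lemma log_derivB s z w : 0 < complex.Im z -> 0 < complex.Im w ->
  log_deriv s w - log_deriv s z =
  (z - w) * \sum_(r <- s) ((z - r%:C)^-1 * (w - r%:C)^-1).
Proof.
move=> z0 w0; rewrite /log_deriv -sumrB mulr_sumr; apply: eq_bigr => r _.
have ? := subr_real_neq0 r z0; have ? := subr_real_neq0 r w0.
by field; apply/andP; split.
Qed.

Lemma normc_sum_resolvents s z w (e : R) (d : nat) : 0 < e ->
  e <= complex.Im z -> e <= complex.Im w -> (size s <= d)%N ->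
  N (\sum_(r <- s) ((z - r%:C)^-1 * (w - r%:C)^-1)) <= d%:R / e ^+ 2.
Proof.
move=> e0 ez ew sd; apply: le_trans (normc_sum _ _) _.
have : (size s)%:R / e ^+ 2 <= d%:R / e ^+ 2.
  by rewrite ler_wpM2r ?invr_ge0 ?sqr_ge0 ?ler_nat.
apply: le_trans; apply: ler_sum_size => r.
rewrite Normc.normcM expr2 invfM ler_pM ?normc_ge0//.
  exact: normc_resolvent_le.
exact: normc_resolvent_le.
Qed.

Lemma log_deriv_lipschitz s z w (e : R) (d : nat) : 0 < e ->
  e <= complex.Im z -> e <= complex.Im w -> (size s <= d)%N ->
  N (log_deriv s w - log_deriv s z) <= d%:R / e ^+ 2 * N (w - z).
Proof.
move=> e0 ez ew sd; rewrite log_derivB ?(lt_le_trans e0)// Normc.normcM mulrC.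
by rewrite normc_distC ler_wpM2r ?normc_ge0// normc_sum_resolvents.
Qed.

(* One Newton step z |-> z - 1/L(z), combined with one differentiation
   L |-> L + L'/L, changes L(z) only at second order. *)
Lemma newton_step s z (c e : R) (d : nat) :
  let L := log_deriv s in let w := z - (L z)^-1 in
  let L' := fun u => L u - (\sum_(r <- s) ((u - r%:C)^-1) ^+ 2) / L u in
  0 < c -> 0 < e -> (size s <= d)%N ->
  e <= complex.Im z -> e <= complex.Im w ->
  c * d%:R <= N (L z) -> 2 * (c * e ^+ 2)^-1 <= c * d%:R ->
  N (L' w - L z) <= ((c ^+ 2 * e ^+ 3)^-1 + 2 * (c ^+ 3 * e ^+ 4)^-1) / d%:R.
Proof.
move=> L w L' c0 e0 sd ez ew cL big.
have ce0 : 0 < (c * e ^+ 2)^-1 by rewrite invr_gt0 mulr_gt0 ?exprn_gt0.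
have cd0 : 0 < c * d%:R by apply: lt_le_trans big; rewrite mulr_gt0.
have d0 : 0 < d%:R :> R by rewrite -(pmulr_rgt0 _ c0).
have z0 := lt_le_trans e0 ez; have w0 := lt_le_trans e0 ew.
set B := \sum_(r <- s) ((z - r%:C)^-1 * (w - r%:C)^-1).
set B' := \sum_(r <- s) ((w - r%:C)^-1 ^+ 2).
have Lz0 : L z != 0 by rewrite -normc_gt0 (lt_le_trans cd0).
(* Exact, because z - w = 1 / L z; this is the first-order change that B' / L w is to cancel. *)
have LwLz : L w - L z = B / L z.
  by rewrite log_derivB// /w opprB addrCA subrr addr0 mulrC.
have NB : N B <= d%:R / e ^+ 2 by exact: normc_sum_resolvents.
have NB' : N B' <= d%:R / e ^+ 2.
  by rewrite /B'; under eq_bigr do rewrite expr2; exact: normc_sum_resolvents.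
have NLwLz : N (L w - L z) <= (c * e ^+ 2)^-1.
  rewrite LwLz Normc.normcM Normc.normcV ler_pdivrMr ?(lt_le_trans cd0)//.
  apply: le_trans NB _; apply: le_trans (ler_wpM2l (ltW ce0) cL).
  rewrite le_eqVlt; apply/orP; left; apply/eqP; field.
  by rewrite !gt_eqF.
(* The hypothesis [big] makes the increment of L at most half of c d. *)
have cLw : c * d%:R / 2 <= N (L w).
  have := normc_triangle (L z) 0 (L w); rewrite !subr0 normc_distC.
  by move: NLwLz cL big; lra.
have cd20 : 0 < c * d%:R / 2 by rewrite divr_gt0.
have Lw0 : L w != 0 by rewrite -normc_gt0 (lt_le_trans cd20).
have BB' : N (B - B') <= (c * e ^+ 3)^-1.
  (* The resolvent identity once more: a third-order sum over the roots, of size d / e^3, divided by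
     L z of order d. *)
  have -> : B - B' = - (L z)^-1 * \sum_(r <- s)
      ((z - r%:C)^-1 * (w - r%:C)^-1 * (w - r%:C)^-1).
    rewrite -sumrB mulr_sumr; apply: eq_bigr => r _.
    have ? := subr_real_neq0 r z0; have ? := subr_real_neq0 r w0.
    have -> : - (L z)^-1 = w - z by rewrite /w addrAC subrr add0r.
    by field; apply/andP; split.
  rewrite Normc.normcM normcN Normc.normcV.
  rewrite mulrC ler_pdivrMr ?(lt_le_trans cd0)//.
  apply: (@le_trans _ _ (d%:R / e ^+ 3)); last first.
    have -> : d%:R / e ^+ 3 = (c * e ^+ 3)^-1 * (c * d%:R).
      by field; rewrite !gt_eqF.
    by rewrite ler_wpM2l// invr_ge0 ltW// mulr_gt0// exprn_gt0.
  apply: le_trans (normc_sum _ _) _.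
  have : (size s)%:R / e ^+ 3 <= d%:R / e ^+ 3.
    by rewrite ler_wpM2r ?ler_nat// invr_ge0 ltW// exprn_gt0.
  apply: le_trans; apply: ler_sum_size => r.
  rewrite !Normc.normcM !exprS expr0 mulr1 !invfM mulrA.
  by rewrite !ler_pM ?mulr_ge0 ?normc_ge0//; exact: normc_resolvent_le.
(* The second term is the cost of replacing 1 / L w by 1 / L z. The two terms are bounded by 1 /
   (c^2 e^3 d) and 2 / (c^3 e^4 d), which is the origin of the constant. *)
have -> : L' w - L z = (B - B') / L z + B' * B / (L z ^+ 2 * L w).
  have -> : L' w - L z = B / L z - B' / L w.
    by rewrite /L' addrAC LwLz.
  have -> : B' / L w = B' / L z - B' * ((L w - L z) / (L z * L w)).
    by field; apply/andP; split.
  by rewrite LwLz; field; apply/andP; split.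
apply: le_trans (le_normcD _ _) _; rewrite [leRHS]mulrDl; apply: lerD.
  rewrite Normc.normcM Normc.normcV ler_pdivrMr ?(lt_le_trans cd0)//.
  apply: le_trans BB' _.
  have -> : (c * e ^+ 3)^-1 = (c ^+ 2 * e ^+ 3)^-1 / d%:R * (c * d%:R).
    by field; rewrite !gt_eqF.
  rewrite ler_wpM2l// ltW// divr_gt0// invr_gt0 mulr_gt0// exprn_gt0//.
rewrite !Normc.normcM Normc.normcV Normc.normcM expr2 Normc.normcM.
rewrite ler_pdivrMr; last by rewrite !mulr_gt0 // normc_gt0.
apply: (@le_trans _ _ ((d%:R / e ^+ 2) * (d%:R / e ^+ 2))).
  by rewrite ler_pM ?normc_ge0.
have -> : d%:R / e ^+ 2 * (d%:R / e ^+ 2) =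
   2 * (c ^+ 3 * e ^+ 4)^-1 / d%:R *
   ((c * d%:R) * (c * d%:R) * (c * d%:R / 2)).
  by field; rewrite !gt_eqF.
apply: ler_wpM2l.
  rewrite mulr_ge0 ?invr_ge0 ?ler0n// mulr_ge0// invr_ge0 ltW// mulr_gt0//.
    by rewrite exprn_gt0.
  by rewrite exprn_gt0.
apply: ler_pM => //; [by rewrite mulr_ge0 ?(ltW cd0)|exact: ltW|].
by apply: ler_pM => //; exact: ltW.
Qed.

(** Induction on m with drifts m / d times K for the value and m / d times K / (c^2 d) for the
    position; M <= d caps them at their final sizes. Since |L_0| starts above 2 c d and K <= c d,
    the value stays above c d, and since the position strays by at most e from a line of height 2 e,
    it stays above e: both are what a further [newton_step] requires. *)
Lemma newton_iterates (S : nat -> seq R) (d M : nat) z0 (c e : R) :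
  let K := (c ^+ 2 * e ^+ 3)^-1 + 2 * (c ^+ 3 * e ^+ 4)^-1 in
  let L := fun m => log_deriv (S m) in
  0 < c -> 0 < e -> (M <= d)%N ->
  (forall m, (m <= M)%N -> (size (S m) <= d)%N) ->
  (forall m z, (m < M)%N -> 0 < complex.Im z ->
     L m.+1 z = L m z - (\sum_(r <- S m) ((z - r%:C)^-1) ^+ 2) / L m z) ->
  2 * (c * d%:R) <= N (L 0%N z0) ->
  2 * e <= complex.Im z0 ->
  2 * e <= complex.Im (z0 - M%:R * (L 0%N z0)^-1) ->
  2 * (c * e ^+ 2)^-1 <= c * d%:R -> K <= c * d%:R ->
  K / (c ^+ 2 * d%:R) <= e ->
  exists z, [/\ e <= complex.Im z,
    N (L M z - L 0%N z0) <= K &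
    N (z - (z0 - M%:R * (L 0%N z0)^-1)) <= K / (c ^+ 2 * d%:R)].
Proof.
move=> K L c0 e0 Md Sd Lrec cL ez0 ezM big1 big2 big3.
have K0 : 0 < K.
  by rewrite addr_gt0 ?mulr_gt0 ?invr_gt0 ?mulr_gt0 ?exprn_gt0.
have cd0 : 0 < c * d%:R by exact: lt_le_trans big2.
have d0 : 0 < d%:R :> R by rewrite -(pmulr_rgt0 _ c0).
have L00 : L 0%N z0 != 0 by rewrite -normc_gt0 (lt_le_trans _ cL)// mulr_gt0.
have frac m : (m <= M)%N -> 0 <= (m%:R / d%:R : R) <= 1.
  move=> mM; rewrite divr_ge0 ?ler0n// ler_pdivrMr// mul1r ler_nat.
  exact: leq_trans Md.
(* The imaginary part is monotone in m along the line, so the bounds at the two ends suffice. *)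
have line m : (m <= M)%N -> 2 * e <= complex.Im (z0 - m%:R * (L 0%N z0)^-1).
  have ImMn n (u : R[i]) : complex.Im (n%:R * u) = n%:R * complex.Im u.
    rewrite mulr_natl; elim: n => [|n IH]; first by rewrite mul0r.
    by rewrite mulrS ImD IH -natr1 mulrDl mul1r addrC.
  move: ezM; rewrite !ImB !ImMn => h mM.
  set q := complex.Im _^-1 in h *.
  have [q0|q0] := leP q 0.
    apply: (le_trans ez0); rewrite lerDl oppr_ge0.
    by rewrite mulr_ge0_le0.
  apply: (le_trans h); rewrite lerD2l lerN2.
  by rewrite ler_wpM2r ?ler_nat// ltW.
suff: forall m, (m <= M)%N -> exists z, [/\ e <= complex.Im z,
    N (L m z - L 0%N z0) <= m%:R / d%:R * K &
    N (z - (z0 - m%:R * (L 0%N z0)^-1)) <= m%:R / d%:R * (K / (c ^+ 2 * d%:R))].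
  move=> /(_ M (leqnn _))[z [h1 h2 h3]]; exists z; split => //.
    apply: (le_trans h2); rewrite ler_piMl ?(ltW K0)//.
    by have /andP[] := frac M (leqnn _).
  apply: (le_trans h3); rewrite ler_piMl//.
    by rewrite divr_ge0 ?(ltW K0)// mulr_ge0 ?sqr_ge0 ?ler0n.
  by have /andP[] := frac M (leqnn _).
elim=> [_|m IH mM].
  exists z0; rewrite !mul0r !subr0 !subrr Normc.normc0; split=> //.
  by apply: le_trans ez0; rewrite ler_peMl ?(ltW e0)// ler1n.
have [z [h1 h2 h3]] := IH (ltnW mM).
have fracS : m.+1%:R / d%:R = m%:R / d%:R + 1 / d%:R :> R.
  by rewrite -natr1 mulrDl.
have cLm : c * d%:R <= N (L m z).
  have := normc_triangle (L 0%N z0) 0 (L m z); rewrite !subr0 normc_distC.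
  have : m%:R / d%:R * K <= K.
    by rewrite ler_piMl ?(ltW K0)//; have /andP[] := frac m (ltnW mM).
  by move: h2 cL big2; lra.
have Lm0 : L m z != 0 by rewrite -normc_gt0 (lt_le_trans cd0).
pose w := z - (L m z)^-1.
have wline : N (w - (z0 - m.+1%:R * (L 0%N z0)^-1)) <=
    m.+1%:R / d%:R * (K / (c ^+ 2 * d%:R)).
  have -> : w - (z0 - m.+1%:R * (L 0%N z0)^-1) =
    (z - (z0 - m%:R * (L 0%N z0)^-1)) + ((L 0%N z0)^-1 - (L m z)^-1).
    by rewrite /w -natr1; ring.
  apply: le_trans (le_normcD _ _) _.
  rewrite fracS [leRHS]mulrDl; apply: lerD => //.
  (* A drift K in the value changes the step by at most K / (c d)^2. *)
  have -> : (L 0%N z0)^-1 - (L m z)^-1 =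
      (L m z - L 0%N z0) * (L 0%N z0)^-1 * (L m z)^-1.
    by field; apply/andP; split.
  rewrite !Normc.normcM !Normc.normcV -mulrA -invfM ler_pdivrMr; last first.
    by rewrite mulr_gt0// normc_gt0.
  apply: (@le_trans _ _ K).
    apply: (le_trans h2); rewrite ler_piMl ?(ltW K0)//.
    by have /andP[] := frac m (ltnW mM).
  have {1}-> : K = 1 / d%:R * (K / (c ^+ 2 * d%:R)) * ((c * d%:R) * (c * d%:R)).
    by field; rewrite !gt_eqF.
  apply: ler_wpM2l.
    apply: mulr_ge0; first by rewrite divr_ge0 ?ler0n.
    by rewrite divr_ge0 ?(ltW K0)// mulr_ge0 ?sqr_ge0 ?ler0n.
  apply: ler_pM; rewrite ?(ltW cd0)//.
  by apply: le_trans cL; rewrite ler_peMl ?(ltW cd0)// ler1n.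
have ew : e <= complex.Im w.
  have := line _ mM; have := normc_ge_normIm (w - (z0 - m.+1%:R * (L 0%N z0)^-1)).
  rewrite ImB ler_norml => /andP[+ _].
  have : m.+1%:R / d%:R * (K / (c ^+ 2 * d%:R)) <= e.
    apply: le_trans big3; rewrite ler_piMl//.
      by rewrite divr_ge0 ?(ltW K0)// mulr_ge0 ?sqr_ge0 ?ler0n.
    by have /andP[] := frac _ mM.
  by move: wline; lra.
exists w; split => //.
have -> : L m.+1 w - L 0%N z0 = (L m.+1 w - L m z) + (L m z - L 0%N z0).
  by rewrite addrA subrK.
apply: le_trans (le_normcD _ _) _; rewrite addrC fracS [leRHS]mulrDl lerD//.
rewrite Lrec ?(lt_le_trans e0)//.
have := newton_step c0 e0 (Sd _ (ltnW mM)) h1 ew cLm big1.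
by move/le_trans; apply; rewrite mul1r mulrC.
Qed.

End NewtonCharacteristics.

(** * Derivatives of real-rooted polynomials *)

Section RealRootedPolynomials.
Context {R : realType}.
Local Open Scope complex_scope.
Implicit Types (z : R[i]) (s : seq R) (p : {poly R}).
Local Notation N := Normc.normc.
Local Notation toC := (map_poly (real_complex R)).

Local Notation rprod s := (\prod_(r <- s) ('X - r%:P)).

Lemma map_rprod s : toC (rprod s) = \prod_(r <- s) ('X - (r%:C)%:P).
Proof. by rewrite rmorph_prod; apply: eq_bigr => r _; rewrite /= map_polyXsubC. Qed.

Lemma horner_rprod s z : (toC (rprod s)).[z] = \prod_(r <- s) (z - r%:C).
Proof.
by rewrite map_rprod horner_prod; apply: eq_bigr => r _; rewrite hornerXsubC.
Qed.

Lemma subr_real_neq0_Im z (r : R) : complex.Im z != 0 -> z - r%:C != 0.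
Proof.
by apply: contraNneq => /eqP; rewrite subr_eq0 => /eqP ->.
Qed.

Lemma horner_rprod_neq0 s z : complex.Im z != 0 -> (toC (rprod s)).[z] != 0.
Proof.
move=> z0; rewrite horner_rprod; elim: s => [|r s IH].
  by rewrite big_nil oner_eq0.
by rewrite big_cons mulf_neq0// subr_real_neq0_Im.
Qed.

Lemma horner_deriv_rprod s z : complex.Im z != 0 ->
  (toC (rprod s))^`().[z] = (toC (rprod s)).[z] * log_deriv s z.
Proof.
move=> z0; rewrite /log_deriv; elim: s => [|r s IH].
  by rewrite !big_nil rmorph1 derivC horner0 mulr0.
rewrite !big_cons rmorphM /= map_polyXsubC derivM derivXsubC mul1r.
rewrite hornerD !hornerM hornerXsubC IH.
by have := subr_real_neq0_Im r z0; set a := (X in X != 0) => a0; field.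
Qed.

Lemma horner_deriv2_rprod s z : complex.Im z != 0 ->
  (toC (rprod s))^`()^`().[z] = (toC (rprod s)).[z] *
    (log_deriv s z ^+ 2 - \sum_(r <- s) ((z - r%:C)^-1) ^+ 2).
Proof.
move=> z0; elim: s => [|r s IH].
  by rewrite /log_deriv !big_nil rmorph1 !derivC horner0 expr2 mul0r subr0 mulr0.
have H := horner_deriv_rprod s z0; rewrite /log_deriv in IH H *.
rewrite !big_cons rmorphM /= map_polyXsubC derivM derivXsubC mul1r derivD.
rewrite derivM derivXsubC mul1r !hornerD !hornerM hornerXsubC IH H.
have := subr_real_neq0_Im r z0; set a := (X in X != 0) => a0.
by field.
Qed.

Lemma Im_log_deriv s z : complex.Im (log_deriv s z) =
  - (complex.Im z * \sum_(r <- s) (N (z - r%:C) ^+ 2)^-1).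
Proof.
rewrite Im_sum mulr_sumr -sumrN; apply: eq_bigr => r _.
by rewrite ImV Im_subr_real.
Qed.

(** Every root contributes to the imaginary part with the sign opposite to that of Im z, so nothing
    cancels. *)
Lemma log_deriv_neq0 s z : (0 < size s)%N -> complex.Im z != 0 ->
  log_deriv s z != 0.
Proof.
move=> s0 z0; apply/eqP => /(congr1 (@complex.Im R)); rewrite Im_log_deriv/=.
apply/eqP; rewrite oppr_eq0 mulf_neq0// gt_eqF//.
case: s s0 => // r s _; rewrite big_cons ltr_pwDl//.
  by rewrite invr_gt0 exprn_gt0// normc_gt0 subr_real_neq0_Im.
by apply: sumr_ge0 => x _; rewrite invr_ge0 sqr_ge0.
Qed.

Lemma real_rooted_monic_prod (d : nat) p : real_rooted_monic d p ->
  exists s, size s = d /\ p = rprod s.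
Proof.
move=> [pm sp rp].
have [rs prs] := closed_field_poly_normal (toC p).
have lc : lead_coef (toC p) = 1.
  by rewrite lead_coef_map (eqP pm) rmorph1.
rewrite lc scale1r in prs.
(* All complex roots are real, so taking real parts loses nothing. *)
pose s := map (@complex.Re R) rs; exists s.
have ps : p = rprod s.
  apply: (map_poly_inj (real_complex R)) => /=.
  rewrite prs map_rprod big_map big_seq [RHS]big_seq; apply: eq_bigr => z zrs.
  have /rp : root (toC p) z by rewrite prs root_prod_XsubC.
  by case: z {zrs} => a b /= ->.
split=> //; apply/succn_inj.
by rewrite -sp ps size_prod_XsubC.
Qed.

(* Gauss-Lucas on the real line. *)
Lemma deriv_rprod s (n : nat) : size s = n.+1 ->
  exists s', size s' = n /\ (rprod s)^`() = n.+1%:R *: rprod s'.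
Proof.
move=> sn; set Q := rprod s.
have sQ : size Q = n.+2 by rewrite size_prod_XsubC sn.
have n0 : n.+1%:R != 0 :> R by rewrite pnatr_eq0.
have Qn : Q`_n.+1 = 1.
  by have := monic_prod_XsubC s xpredT id; rewrite monicE lead_coefE sQ => /eqP.
have sQ' : size Q^`() = n.+1 by rewrite polyorder.size_deriv sQ.
have [] : exists s', size s' = n /\ n.+1%:R^-1 *: Q^`() = rprod s'.
  apply: real_rooted_monic_prod; split.
  - by rewrite monicE lead_coefZ lead_coefE sQ' coef_deriv Qn mulVf.
  - by rewrite size_scale ?invr_eq0.
  move=> z; rewrite (_ : map_poly _ _ = toC (n.+1%:R^-1 *: Q^`()))//.
  rewrite map_polyZ rootZ ?fmorph_eq0 ?invr_eq0// -deriv_map rootE => h.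
  apply/eqP/negP => /negP z0.
  move: h; rewrite horner_deriv_rprod// mulf_eq0.
  by rewrite (negbTE (horner_rprod_neq0 _ _)) ?(negbTE (log_deriv_neq0 _ _)) ?sn.
by move=> s' [ss' e]; exists s'; rewrite -e scalerA mulfV// scale1r.
Qed.

(** One splitting is enough for the choice in [root_seq] to be genuine and its default never
    taken. *)
Lemma root_seqP p s : p = rprod s -> p = rprod (root_seq p).
Proof.
move=> ps; rewrite /root_seq; case: xgetP => [s' -> //|] /(_ s).
by move/(_ ps).
Qed.

Lemma size_root_seq p s : p = rprod s -> size (root_seq p) = size s.
Proof.
move=> ps; have /(congr1 (size : {poly R} -> nat)) := root_seqP ps.
by rewrite {1}ps !size_prod_XsubC => -[].
Qed.

Lemma prod_natr_neq0 (k d : nat) : (\prod_(k.+1 <= i < d.+1) i%:R : R) != 0.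
Proof.
rewrite prodf_seq_neq0; apply/allP => i; rewrite mem_index_iota => /andP[ki _].
by rewrite pnatr_eq0 -lt0n (leq_trans _ ki).
Qed.

Lemma monic_deriv_real_rooted (d m : nat) p : (m <= d)%N ->
  real_rooted_monic d p ->
  p^`(m) = (\prod_((d - m).+1 <= i < d.+1) i%:R) *: monic_deriv (d - m) d p /\
  exists s, size s = (d - m)%N /\ monic_deriv (d - m) d p = rprod s.
Proof.
move=> md hp.
have c0 := prod_natr_neq0 ^~ d.
suff [s [ss e]] : exists s, size s = (d - m)%N /\
    p^`(m) = (\prod_((d - m).+1 <= i < d.+1) i%:R) *: rprod s.
  rewrite /monic_deriv subKn// scalerA mulfV// scale1r; split => //.
  by exists s; rewrite e scalerA mulVf// scale1r.
elim: m md => [_|m IH md].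
  have [s [ss ->]] := real_rooted_monic_prod hp; exists s.
  by rewrite subn0 big_geq// scale1r.
have [s [ss e]] := IH (ltnW md).
have dm : (d - m = (d - m.+1).+1)%N by rewrite subnS prednK// subn_gt0.
rewrite dm in ss; have [s' [ss' e']] := deriv_rprod ss.
exists s'; split=> //; rewrite derivnS e derivZ e' scalerA; congr (_ *: _).
rewrite [RHS]big_ltn; first by rewrite -dm mulrC.
by rewrite ltnS -dm leq_subr.
Qed.

(** With Q the m-th derivative and L' its logarithmic derivative, Q' = Q L' and Q'' = Q (L'^2 - B),
    where B is the sum of squared resolvents; the quotient Q'' / Q' is the logarithmic derivative of
    Q', and the leading coefficients drop out. *)
Lemma log_deriv_monic_deriv (d m : nat) p z : (m < d)%N ->
  real_rooted_monic d p -> complex.Im z != 0 ->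
  let S k := root_seq (monic_deriv (d - k) d p) in
  log_deriv (S m.+1) z = log_deriv (S m) z -
    (\sum_(r <- S m) ((z - r%:C)^-1) ^+ 2) / log_deriv (S m) z.
Proof.
move=> md hp z0 S.
have [e1 [s1 [ss1 h1]]] := monic_deriv_real_rooted (ltnW md) hp.
have [e2 [s2 [_ h2]]] := monic_deriv_real_rooted md hp.
rewrite (root_seqP h1) in e1; rewrite (root_seqP h2) in e2.
have : toC (p^`(m.+1)) = (toC (p^`(m)))^`() by rewrite deriv_map derivnS.
rewrite e1 e2 -/(S m) -/(S m.+1) !map_polyZ derivZ.
move: (prod_natr_neq0 (d - m.+1) d) (prod_natr_neq0 (d - m) d).
rewrite -(fmorph_eq0 (real_complex R)); set a := (X in X != 0 -> _) => a0.
rewrite -(fmorph_eq0 (real_complex R)); set b := (X in X != 0 -> _) => b0.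
move=> E; have /(congr1 (horner^~ z)) := E.
have /(congr1 (fun q => q^`().[z])) := E.
rewrite !derivZ !hornerZ !horner_deriv_rprod// horner_deriv2_rprod//.
set P1 := (toC _).[z]; set P2 := (toC (rprod (S m))).[z].
set L := log_deriv _ z; set L' := log_deriv (S m) z; set B := \sum_(_ <- _) _.
have P10 : P1 != 0 by exact: horner_rprod_neq0.
have P20 : P2 != 0 by exact: horner_rprod_neq0.
have L'0 : L' != 0.
  by apply: log_deriv_neq0 => //; rewrite (size_root_seq h1) ss1 subn_gt0.
move=> H1 H2; apply: (mulfI (mulf_neq0 a0 P10)).
rewrite -mulrA H1 mulrBr H2 -!mulrA; congr (_ * _).
by field.
Qed.

Definition avg s (f : R -> R) : R := (size s)%:R^-1 * \sum_(r <- s) f r.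

Lemma integral_root_measure p s (f : R -> R) : p = rprod s ->
  measurable_fun setT f ->
  (\int[root_measure p]_x (f x)%:E)%E = (avg (root_seq p) f)%:E.
Proof.
move=> ps mf.
have sz : (size p).-1 = size (root_seq p).
  by rewrite (size_root_seq ps) ps size_prod_XsubC.
have ge0 (g : R -> R) : measurable_fun setT g -> (forall x, 0 <= g x) ->
    (\int[root_measure p]_x (g x)%:E)%E = (avg (root_seq p) g)%:E.
  move=> mg g0; rewrite /root_measure ge0_integral_mscale//=; first last.
  - by move=> x _; rewrite lee_fin.
  - exact/measurable_EFinP.
  rewrite ge0_integral_measure_sum//; first last.
  - exact/measurable_EFinP.
  - by move=> x _; rewrite lee_fin.
  rewrite /avg EFinM -sz; congr (_ * _)%E.
  rewrite (big_nth 0) big_mkord -sz -sumEFin; apply: eq_bigr => i _.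
  rewrite integral_dirac//=; last exact/measurable_EFinP.
  by rewrite diracT mul1e.
rewrite integralE funerpos funerneg ge0//; last exact: measurable_funrpos.
rewrite ge0//; last exact: measurable_funrneg.
rewrite -EFinB -mulrBr -sumrB; congr (_ * _)%:E; apply: eq_bigr => r _.
by rewrite -[in RHS](funrposBneg f).
Qed.

End RealRootedPolynomials.

(** * Means and their Cauchy transforms *)

Section Means.
Context {R : realType}.
Local Open Scope complex_scope.
Implicit Types (f g : R -> R) (E : (R -> R) -> R).
Local Notation N := Normc.normc.

Definition Cb f := continuous f /\ exists M, forall x, `|f x| <= M.

Lemma Cb_cst (c : R) : Cb (fun=> c).
Proof. by split; [exact: cst_continuous|exists `|c|]. Qed.

Lemma CbD f g : Cb f -> Cb g -> Cb (fun x => f x + g x).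
Proof.
move=> [cf [A fA]] [cg [B gB]]; split.
  by move=> x; apply: cvgD; [exact: cf|exact: cg].
by exists (A + B) => x; rewrite (le_trans (ler_normD _ _))// lerD.
Qed.

Lemma CbM f g : Cb f -> Cb g -> Cb (fun x => f x * g x).
Proof.
move=> [cf [A fA]] [cg [B gB]]; split.
  by move=> x; apply: cvgM; [exact: cf|exact: cg].
by exists (A * B) => x; rewrite normrM ler_pM.
Qed.

Lemma CbZ (c : R) f : Cb f -> Cb (fun x => c * f x).
Proof. by apply: CbM; exact: Cb_cst. Qed.

Lemma CbB f g : Cb f -> Cb g -> Cb (fun x => f x - g x).
Proof.
move=> [cf [A fA]] [cg [B gB]]; split.
  by move=> x; apply: cvgB; [exact: cf|exact: cg].
by exists (A + B) => x; rewrite (le_trans (ler_normB _ _))// lerD.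
Qed.

Lemma CbN f : Cb f -> Cb (fun x => - f x).
Proof. by move=> /(CbB (Cb_cst 0)); congr Cb; apply/funext => x; rewrite sub0r. Qed.

Lemma Cb_comp f (c : R) : Cb f -> Cb (fun x => f (c * x)).
Proof.
move=> [cf [A fA]]; split; last by exists A.
move=> x; apply: (@continuous_comp _ _ _ ( *%R c) f); last exact: cf.
exact: mulrl_continuous.
Qed.

Lemma Cb_bounded_fun f : continuous f -> bounded_fun f -> Cb f.
Proof.
move=> cf [M [_ hM]]; split=> //; exists (M + 1) => x.
by apply: (hM (M + 1)) => //; rewrite ltrDl.
Qed.

Lemma bounded_fun_Cb f : Cb f -> bounded_fun f.
Proof.
by move=> [_ [M hM]]; exists M; split; [exact: num_real|move=> B /ltW MB x _;
  exact: le_trans (hM x) MB].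
Qed.

(* Averages over finite sequences, integrals against probability measures and
   limits of such, all seen as functionals on bounded continuous functions. *)
Definition mean E :=
  [/\ E (fun=> 1) = 1,
      forall (a : R) f g, Cb f -> Cb g ->
        E (fun x => a * f x + g x) = a * E f + E g &
      forall f g, Cb f -> Cb g -> (forall x, f x <= g x) -> E f <= E g].

Section MeanTheory.
Variables (E : (R -> R) -> R) (hE : mean E).

Lemma mean_linear (a : R) f g : Cb f -> Cb g ->
  E (fun x => a * f x + g x) = a * E f + E g.
Proof. by case: hE => _ h _; exact: h. Qed.

Lemma le_mean f g : Cb f -> Cb g -> (forall x, f x <= g x) -> E f <= E g.
Proof. by case: hE => _ _ h; exact: h. Qed.

Lemma mean0 : E (fun=> 0) = 0.
Proof.
case: hE => h1 h2 _; have := h2 (-1) _ _ (Cb_cst 1) (Cb_cst 1).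
by rewrite h1 mulN1r addNr => H; rewrite -[RHS]H; congr E; apply/funext.
Qed.

Lemma meanD f g : Cb f -> Cb g -> E (fun x => f x + g x) = E f + E g.
Proof.
move=> cf cg; rewrite -[E f]mul1r -mean_linear//; congr E.
by apply/funext => x; rewrite mul1r.
Qed.

Lemma meanZ (a : R) f : Cb f -> E (fun x => a * f x) = a * E f.
Proof.
move=> cf; have := mean_linear a cf (Cb_cst 0); rewrite mean0 addr0 => <-.
by congr E; apply/funext => x; rewrite addr0.
Qed.

Lemma meanN f : Cb f -> E (fun x => - f x) = - E f.
Proof.
move=> cf; rewrite -mulN1r -meanZ//; congr E.
by apply/funext => x; rewrite mulN1r.
Qed.

Lemma meanB f g : Cb f -> Cb g -> E (fun x => f x - g x) = E f - E g.
Proof.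
move=> cf cg; rewrite meanD//; last exact: CbN.
by rewrite meanN.
Qed.

Lemma mean_cst (c : R) : E (fun=> c) = c.
Proof.
rewrite -[RHS]mulr1; case: (hE) => <- _ _; rewrite -meanZ; last exact: Cb_cst.
by congr E; apply/funext => x; rewrite mulr1.
Qed.

Lemma mean_ge0 f : Cb f -> (forall x, 0 <= f x) -> 0 <= E f.
Proof. by move=> cf f0; rewrite -mean0 le_mean//; exact: Cb_cst. Qed.

Lemma mean_norm_le f g : Cb f -> Cb g -> (forall x, `|f x| <= g x) ->
  `|E f| <= E g.
Proof.
move=> cf cg fg; rewrite ler_norml; apply/andP; split.
  rewrite lerNl -meanN//; apply: le_mean => //; first exact: CbN.
  by move=> x; rewrite lerNl; have := fg x; rewrite ler_norml => /andP[].
by apply: le_mean => // x; have := fg x; rewrite ler_norml => /andP[].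
Qed.

Lemma mean_bound f (M : R) : Cb f -> (forall x, `|f x| <= M) -> `|E f| <= M.
Proof.
by move=> cf fM; rewrite -[leRHS]mean_cst mean_norm_le//; exact: Cb_cst.
Qed.

End MeanTheory.

Lemma mean_avg (s : seq R) : (0 < size s)%N -> mean (avg s).
Proof.
move=> s0; have n0 : (size s)%:R != 0 :> R by rewrite pnatr_eq0 -lt0n.
split; rewrite /avg.
- by rewrite big_const_seq count_predT iter_addr_0 mulVf.
- move=> a f g _ _; rewrite big_split/= -mulr_sumr mulrDr.
  by rewrite mulrCA.
- move=> f g _ _ fg; rewrite ler_wpM2l ?invr_ge0//.
  exact: ler_sum.
Qed.

Lemma integrable_Cb (mu : probability (measurableTypeR R) R) f : Cb f ->
  mu.-integrable setT (EFin \o f).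
Proof.
move=> [cf [M fM]]; apply: (@measurable_bounded_integrable _ _ _ mu f setT).
- exact: measurableT.
- by have := ltry (1 : R); rewrite -[X in (X < _)%E](probability_setT mu); exact.
- exact: continuous_measurable_fun.
- by apply: bounded_fun_Cb; split=> //; exists M.
Qed.

Lemma integral_Cb (mu : probability (measurableTypeR R) R) f : Cb f ->
  (\int[mu]_x (f x)%:E)%E = (\int[mu]_x f x)%:E.
Proof.
move=> cf; rewrite fineK//; apply: integrable_fin_num => //.
exact: integrable_Cb.
Qed.

Lemma mean_Rintegral (mu : probability (measurableTypeR R) R) :
  mean (fun f => \int[mu]_x f x).
Proof.
split.
- rewrite Rintegral_cst// mul1r /=.
  by rewrite (_ : mu setT = 1%E)//; exact: probability_setT.
- move=> a f g cf cg; rewrite RintegralD//.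
  + by rewrite RintegralZl//; exact: integrable_Cb.
  + by apply: integrable_Cb; exact: CbZ.
  + exact: integrable_Cb.
- move=> f g cf cg fg; apply: le_Rintegral => //; exact: integrable_Cb.
Qed.

Lemma mean_lim (E : nat -> (R -> R) -> R) : (forall j, mean (E j)) ->
  (forall f, Cb f -> cvgn (E ^~ f)) -> mean (fun f => limn (E ^~ f)).
Proof.
move=> mE cE; split.
- rewrite (_ : E ^~ _ = fun=> 1) ?lim_cst//.
  by apply/funext => j; case: (mE j).
- move=> a f g cf cg; apply/cvg_lim => //.
  rewrite (_ : E ^~ _ = fun j => a * E j f + E j g).
    by apply: cvgD; [apply: cvgMr; exact: cE cf|exact: cE cg].
  by apply/funext => j; rewrite (mean_linear (mE j)).
- move=> f g cf cg fg; apply: ler_lim; [exact: cE|exact: cE|].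
  by apply: nearW => j; exact: le_mean (mE j) _ _ cf cg fg.
Qed.

(** A bounded continuous substitute for the indicator of |x| >= y. It equals 1 - Re (i y / (i y -
    x)), so its mean can be read off the Cauchy transform at i y. *)
Definition tail (y x : R) : R := x ^+ 2 / (x ^+ 2 + y ^+ 2).

Lemma tail_ge0 y x : 0 <= tail y x.
Proof. by rewrite divr_ge0 ?addr_ge0 ?sqr_ge0. Qed.

Lemma tail_le1 y x : tail y x <= 1.
Proof.
have [->|x0] := eqVneq x 0; first by rewrite /tail expr0n mul0r.
have x2 : 0 < x ^+ 2 by rewrite exprn_even_gt0.
rewrite /tail ler_pdivrMr ?ltr_wpDr ?sqr_ge0//.
by rewrite mul1r lerDl sqr_ge0.
Qed.

Lemma tail_ge_half y x : 0 < y -> y <= `|x| -> 1 <= 2 * tail y x.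
Proof.
move=> y0 yx; have x0 : 0 < `|x| by exact: lt_le_trans yx.
have x2 : 0 < x ^+ 2 by rewrite exprn_even_gt0// -normr_gt0.
rewrite /tail mulrA ler_pdivlMr ?ltr_wpDr ?sqr_ge0//.
rewrite -(real_normK (num_real x)); nra.
Qed.

Lemma Cb_tail y : 0 < y -> Cb (tail y).
Proof.
move=> y0; split; last first.
  by exists 1 => x; rewrite ger0_norm ?tail_ge0// tail_le1.
move=> x; apply: cvgM; first exact: exprn_continuous.
apply: cvgV; first by rewrite gt_eqF// ltr_wpDl ?sqr_ge0// exprn_gt0.
by apply: cvgD; [exact: exprn_continuous|exact: cvg_cst].
Qed.

Definition tight E := forall e : R, 0 < e -> exists2 y, 0 < y & E (tail y) <= e.

Lemma tight_Rintegral (mu : probability (measurableTypeR R) R) :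
  tight (fun f => \int[mu]_x f x).
Proof.
move=> e e0.
have lim0 x : tail n.+1%:R x @[n --> \oo] --> 0.
  rewrite -(mulr0 (x ^+ 2)); apply: cvgMr.
  apply: (@squeeze_cvgr _ _ _ _ (fun=> 0) (fun n : nat => n.+1%:R^-1 : R)).
  - apply: nearW => n; rewrite invr_ge0 addr_ge0 ?sqr_ge0//= lef_pV2 ?posrE//.
      rewrite -[leLHS]add0r lerD ?sqr_ge0// expr2 ler_peMr ?ler0n// ler1n//.
    by rewrite ltr_wpDl ?sqr_ge0// exprn_gt0.
  - exact: cvg_cst.
  - exact: cvg_harmonic.
have cvg0 : (\int[mu]_x (tail n.+1%:R x)%:E)%E @[n --> \oo] --> 0%E.
  rewrite -[X in _ --> X](integral0 mu setT).
  apply: (@dominated_cvg _ _ _ mu setT _ (fun n x => (tail n.+1%:R x)%:E)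
    (fun=> 0%E) (fun=> 1%E)) => //.
  - move=> n; apply/measurable_EFinP; apply: continuous_measurable_fun.
    by have [] := @Cb_tail n.+1%:R (ltr0Sn _ _).
  - by move=> x _; apply/cvg_EFin; [exact: nearW|exact: lim0].
  - by have := integrable_Cb mu (Cb_cst 1).
  - by move=> n x _; rewrite abse_EFin lee_fin ger0_norm ?tail_ge0// tail_le1.
have /fine_cvgP[_ /cvgrPdist_le/(_ _ e0)[n _ /(_ n (leqnn n))]] := cvg0.
rewrite /= sub0r normrN => /(le_trans (ler_norm _)) h.
by exists n.+1%:R.
Qed.

End Means.

(** * Complex-valued means and Cauchy transforms on cones *)

Section ComplexMeans.
Context {R : realType}.
Local Open Scope complex_scope.
Implicit Types (z w : R[i]) (phi psi : R -> R[i]) (E : (R -> R) -> R).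
Local Notation N := Normc.normc.

Definition CbC phi :=
  Cb (fun x => complex.Re (phi x)) /\ Cb (fun x => complex.Im (phi x)).

Definition cmean E phi : R[i] :=
  E (fun x => complex.Re (phi x)) +i* E (fun x => complex.Im (phi x)).

Lemma CbC_cst z : CbC (fun=> z).
Proof. by split; exact: Cb_cst. Qed.

Lemma CbCM phi psi : CbC phi -> CbC psi -> CbC (fun x => phi x * psi x).
Proof.
move=> [f1 f2] [g1 g2]; split.
  by under [X in Cb X]funext do rewrite ReM; apply: CbB; exact: CbM.
by under [X in Cb X]funext do rewrite ImM; apply: CbD; exact: CbM.
Qed.

Lemma CbCB phi psi : CbC phi -> CbC psi -> CbC (fun x => phi x - psi x).
Proof.
move=> [f1 f2] [g1 g2]; split.
  by under [X in Cb X]funext do rewrite ReB; exact: CbB.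
by under [X in Cb X]funext do rewrite ImB; exact: CbB.
Qed.

Definition resolvent z (x : R) : R[i] := (z - x%:C)^-1.

Lemma CbC_resolvent z : 0 < complex.Im z -> CbC (resolvent z).
Proof.
move=> z0.
have sq x : 0 < (complex.Re z - x) ^+ 2 + complex.Im z ^+ 2.
  by rewrite ltr_wpDl ?sqr_ge0// exprn_gt0.
have bd x : N (resolvent z x) <= (complex.Im z)^-1 by exact: normc_resolvent_le.
have cden x : {for x, continuous (fun x : R =>
    ((complex.Re z - x) ^+ 2 + complex.Im z ^+ 2)^-1)}.
  apply: cvgV; first by rewrite gt_eqF.
  apply: cvgD; last exact: cvg_cst.
  apply: (@continuous_comp _ _ _ (fun x => complex.Re z - x) (fun x => x ^+ 2)).
    by apply: cvgB; [exact: cvg_cst|exact: cvg_id].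
  exact: exprn_continuous.
split; split.
- under [X in continuous X]funext
    do rewrite ReV sqr_normc_Re_Im Re_subr_real Im_subr_real.
  move=> x; apply: cvgM; last exact: cden.
  by apply: cvgB; [exact: cvg_cst|exact: cvg_id].
- by exists (complex.Im z)^-1 => x; exact: le_trans (normc_ge_normRe _) (bd x).
- under [X in continuous X]funext
    do rewrite ImV sqr_normc_Re_Im Re_subr_real Im_subr_real.
  by move=> x; apply: cvgN; apply: cvgM; [exact: cvg_cst|exact: cden].
- by exists (complex.Im z)^-1 => x; exact: le_trans (normc_ge_normIm _) (bd x).
Qed.

Definition cauchy E z := cmean E (resolvent z).

Section CmeanTheory.
Variables (E : (R -> R) -> R) (hE : mean E).

Lemma eqC z w : complex.Re z = complex.Re w -> complex.Im z = complex.Im w ->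
  z = w.
Proof. by case: z => ? ?; case: w => ? ? /= -> ->. Qed.

Lemma cmeanD phi psi : CbC phi -> CbC psi ->
  cmean E (fun x => phi x + psi x) = cmean E phi + cmean E psi.
Proof.
move=> [f1 f2] [g1 g2]; apply: eqC; rewrite ?ReD ?ImD /=.
  by rewrite -(meanD hE)//; congr E; apply/funext => x; rewrite ReD.
by rewrite -(meanD hE)//; congr E; apply/funext => x; rewrite ImD.
Qed.

Lemma cmeanZ z phi : CbC phi -> cmean E (fun x => z * phi x) = z * cmean E phi.
Proof.
move=> [f1 f2]; apply: eqC; rewrite ?ReM ?ImM /=.
  rewrite -!(meanZ hE)// -(meanB hE) ?CbZ//; try exact: CbZ.
  by congr E; apply/funext => x; rewrite ReM.
rewrite -!(meanZ hE)// -(meanD hE) ?CbZ//; try exact: CbZ.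
by congr E; apply/funext => x; rewrite ImM.
Qed.

Lemma cmeanB phi psi : CbC phi -> CbC psi ->
  cmean E (fun x => phi x - psi x) = cmean E phi - cmean E psi.
Proof.
move=> cf cg; rewrite -mulN1r -cmeanZ// -cmeanD//.
  by congr cmean; apply/funext => x; rewrite mulN1r.
by apply: CbCM => //; exact: CbC_cst.
Qed.

Lemma cmean_cst z : cmean E (fun=> z) = z.
Proof. by rewrite /cmean !(mean_cst hE); case: z. Qed.

(** The factor 2 comes from bounding real and imaginary parts separately. *)
Lemma normc_cmean_le phi (g : R -> R) : CbC phi -> Cb g ->
  (forall x, N (phi x) <= g x) -> N (cmean E phi) <= 2 * E g.
Proof.
move=> [f1 f2] cg fg; apply: le_trans (normc_le_Re_Im _) _.
rewrite mulr_natl mulr2n; apply: lerD; apply: (mean_norm_le hE) => // x.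
  exact: le_trans (normc_ge_normRe _) (fg x).
exact: le_trans (normc_ge_normIm _) (fg x).
Qed.

Lemma cauchyB z w : 0 < complex.Im z -> 0 < complex.Im w ->
  cauchy E z - cauchy E w =
  (w - z) * cmean E (fun x => resolvent z x * resolvent w x).
Proof.
move=> z0 w0; rewrite -cmeanB; try exact: CbC_resolvent.
rewrite -cmeanZ; last by apply: CbCM; exact: CbC_resolvent.
congr cmean; apply/funext => x.
have := subr_real_neq0 x z0; have := subr_real_neq0 x w0.
by rewrite /resolvent => ? ?; field; apply/andP; split.
Qed.

End CmeanTheory.

Lemma normc_cone (a b : R) z : 0 <= b -> truncated_cone a b z ->
  0 < complex.Im z /\ N z <= (1 + a) * complex.Im z.
Proof.
move=> b0 [h1 h2]; have z0 : 0 < complex.Im z by exact: le_lt_trans h2.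
split=> //; apply: le_trans (normc_le_Re_Im _) _.
by rewrite (ger0_norm (ltW z0)); lra.
Qed.

Section ConeAsymptotics.
Variables (E : (R -> R) -> R) (hE : mean E) (tE : tight E).

(** The quantity in the second bound is x / (z - x). If |x| < Y, the height Y / e of z makes it at
    most e; otherwise |x| <= |z| + |z - x| <= (2 + a) |z - x|, and 2 [tail Y x] is at least 1. *)
Lemma resolvent_pointwise (a e Y : R) z x : 0 < a -> 0 < e -> 0 < Y ->
  truncated_cone a (Y / e) z ->
  N (z * resolvent z x) <= 1 + a /\
  N (z * resolvent z x - 1) <= e + 2 * (2 + a) * tail Y x.
Proof.
move=> a0 e0 Y0 cz; have b0 : 0 < Y / e by rewrite divr_gt0.
have [z0 Nz] := normc_cone (ltW b0) cz.
have zx := normc_subr_real_ge z x.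
have d0 : 0 < N (z - x%:C) by exact: lt_le_trans zx.
have zx0 := subr_real_neq0 x z0.
have h1 : N (z * resolvent z x) <= 1 + a.
  rewrite Normc.normcM Normc.normcV ler_pdivrMr//.
  apply: (le_trans Nz); rewrite ler_wpM2l// ltW//; lra.
split=> //.
have -> : z * resolvent z x - 1 = x%:C * resolvent z x.
  by rewrite /resolvent; field.
rewrite Normc.normcM Normc.normcV normc_real ler_pdivrMr//.
have [xY|Yx] := leP Y `|x|; last first.
  apply: (@le_trans _ _ (e * N (z - x%:C))); last first.
    rewrite ler_wpM2r ?normc_ge0// lerDl mulr_ge0 ?tail_ge0//; lra.
  apply: (le_trans (ltW Yx)); rewrite mulrC -ler_pdivrMr//.
  by case: cz => _ /ltW bz; exact: le_trans bz zx.
apply: (@le_trans _ _ ((2 + a) * N (z - x%:C))).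
  have -> : `|x| = N (z - (z - x%:C)) by rewrite subKr normc_real.
  apply: le_trans (normcB _ _) _.
  have : (1 + a) * complex.Im z <= (1 + a) * N (z - x%:C).
    rewrite ler_wpM2l//; lra.
  move: Nz; lra.
rewrite ler_wpM2r ?normc_ge0//.
have := tail_ge_half Y0 xY; nra.
Qed.

(** The second estimate concerns the difference quotient of the Cauchy transform, by [cauchyB]; it
    yields the Lipschitz half of [near_identity]. *)
Lemma cauchy_asymptotics (a e : R) : 0 < a -> 0 < e -> exists2 b, 0 < b &
  forall z w, truncated_cone a b z -> truncated_cone a b w ->
    N (z * cauchy E z - 1) <= e /\
    N (z * w * cmean E (fun x => resolvent z x * resolvent w x) - 1) <= e.
Proof.
move=> a0 e0.
(* [d] bounds the tail and [d'] the part near the origin; after the factor 2 of [normc_cmean_le]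
   each contributes e / 2 to the second estimate. *)
pose d := e / (8 * (2 + a) * (2 + a)).
have A0 : 0 < 8 * (2 + a) * (2 + a) by rewrite !mulr_gt0//; lra.
have d0 : 0 < d by rewrite divr_gt0.
have [Y Y0 hY] := tE d0.
pose d' := e / (4 * (2 + a)).
have d'0 : 0 < d' by rewrite divr_gt0// mulr_gt0//; lra.
exists (Y / d'); first by rewrite divr_gt0.
move=> z w cz cw; have b0 : 0 <= Y / d' by rewrite ltW// divr_gt0.
have [z0 _] := normc_cone b0 cz; have [w0 _] := normc_cone b0 cw.
have rz := CbC_resolvent z0; have rw := CbC_resolvent w0.
have cg (c c' : R) : Cb (fun x => c + c' * tail Y x).
  by apply: CbD; [exact: Cb_cst|apply: CbZ; exact: Cb_tail].
have Eg (c c' : R) : E (fun x => c + c' * tail Y x) = c + c' * E (tail Y).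
  rewrite (meanD hE) ?(mean_cst hE) ?(meanZ hE)//; try exact: Cb_tail.
    exact: Cb_cst.
  by apply: CbZ; exact: Cb_tail.
have fin : 2 * ((2 + a) * d' + (2 + a) * (2 * (2 + a)) * E (tail Y)) <= e.
  apply: (@le_trans _ _ (2 * ((2 + a) * d' + (2 + a) * (2 * (2 + a)) * d))).
    rewrite ler_wpM2l// lerD2l ler_wpM2l//; rewrite !mulr_ge0//; lra.
  rewrite /d /d'; rewrite le_eqVlt; apply/orP; left; apply/eqP; field.
  by rewrite gt_eqF//; lra.
have Et0 : 0 <= E (tail Y).
  by apply: (mean_ge0 hE); [exact: Cb_tail|move=> x; exact: tail_ge0].
split.
  rewrite -(cmeanZ hE)// -(cmean_cst hE 1) -(cmeanB hE)//; last 2 first.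
  - by apply: CbCM => //; exact: CbC_cst.
  - exact: CbC_cst.
  apply: (le_trans (normc_cmean_le hE
    (g := fun x => d' + 2 * (2 + a) * tail Y x) _ _ _)).
  - apply: CbCB; last exact: CbC_cst.
    by apply: CbCM => //; exact: CbC_cst.
  - exact: cg.
  - by move=> x; have [] := resolvent_pointwise x a0 d'0 Y0 cz.
  rewrite Eg; apply: le_trans fin; rewrite ler_wpM2l//.
  nra.
rewrite -(cmeanZ hE); last exact: CbCM.
rewrite -(cmean_cst hE 1) -(cmeanB hE)//; last 2 first.
- by apply: CbCM; [exact: CbC_cst|exact: CbCM].
- exact: CbC_cst.
apply: (le_trans (normc_cmean_le hE
  (g := fun x => (2 + a) * d' + (2 + a) * (2 * (2 + a)) * tail Y x) _ _ _)).
- apply: CbCB; last exact: CbC_cst.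
  by apply: CbCM; [exact: CbC_cst|exact: CbCM].
- exact: cg.
- move=> x.
  have [h1 h2] := resolvent_pointwise x a0 d'0 Y0 cz.
  have [h3 h4] := resolvent_pointwise x a0 d'0 Y0 cw.
  (* Of the form u v - 1 = (u - 1) v + (v - 1) with |v| <= 1 + a, which costs one more factor 2 +
     a. *)
  have -> : z * w * (resolvent z x * resolvent w x) - 1 =
    (z * resolvent z x - 1) * (w * resolvent w x) + (w * resolvent w x - 1).
    by ring.
  apply: le_trans (le_normcD _ _) _; rewrite Normc.normcM.
  have := ler_pM (normc_ge0 _) (normc_ge0 _) h2 h3.
  lra.
by rewrite Eg.
Qed.

End ConeAsymptotics.

(** The second clause replaces f' -> 1 at infinity. The height b may depend on the aperture a, as
    tightness alone gives nothing uniform over the whole half-plane. *)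
Definition near_identity (f : R[i] -> R[i]) := forall a e : R, 0 < a -> 0 < e ->
  exists2 b, 0 < b & forall z w, truncated_cone a b z -> truncated_cone a b w ->
    N (f z - z) <= e * N z /\ N ((f z - z) - (f w - w)) <= e * N (z - w).

Lemma near_identity_recip_cauchy E : mean E -> tight E ->
  near_identity (fun z => (cauchy E z)^-1).
Proof.
move=> hE tE a e a0 e0.
(* d <= 1/4 keeps |z G z| >= 3/4; the Lipschitz constant is then at most (13/4) d / (9/16), below 8
   d. *)
pose d := Num.min (4^-1) (e / 8).
have d0 : 0 < d by rewrite lt_min divr_gt0// invr_gt0 ltr0n.
have d4 : d <= 4^-1 by rewrite ge_min lexx.
have d8 : 8 * d <= e by rewrite mulrC -ler_pdivlMr// ge_min lexx orbT.
have [b b0 hb] := cauchy_asymptotics hE tE a0 d0.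
exists b => // z w cz cw.
have [hz hzw] := hb _ _ cz cw; have [hw _] := hb _ _ cw cz.
have [z0 _] := normc_cone (ltW b0) cz; have [w0 _] := normc_cone (ltW b0) cw.
have half u v : N (u * v - 1) <= d -> 3 / 4 <= N (u * v) /\ v != 0.
  move=> h; have h' : 3 / 4 <= N (u * v).
    have := normc_triangle 1 0 (u * v); rewrite !subr0 Normc.normc1 normc_distC.
    by move: h d4; lra.
  split=> //; apply/eqP => v0; move: h'; rewrite v0 mulr0 Normc.normc0; lra.
have [zc Gz0] := half _ _ hz; have [wc Gw0] := half _ _ hw.
set G := cauchy E in hz hw Gz0 Gw0 zc wc *.
have zn0 := Im_gt0_neq0 z0; have wn0 := Im_gt0_neq0 w0.
split.
  have -> : (G z)^-1 - z = - (z * (z * G z - 1) / (z * G z)).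
    by field; apply/andP; split.
  rewrite normcN 2!Normc.normcM Normc.normcV -mulrA mulrC ler_wpM2r ?normc_ge0//.
  rewrite ler_pdivrMr; last by move: zc; lra.
  have : 3 / 4 * e <= e * N (z * G z) by rewrite mulrC ler_wpM2l// ltW.
  move: hz d8 d0; lra.
set D := cmean E _ in hzw.
have GB : G w - G z = (z - w) * D.
  rewrite (cauchyB hE w0 z0); congr (_ * cmean E _).
  by apply/funext => x; rewrite mulrC.
(* The factor of z - w is D / (G z G w) - 1, written through the three quantities z w D, z G z and w
   G w, all close to 1. *)
have -> : (G z)^-1 - z - ((G w)^-1 - w) =
  (z - w) * (((z * w * D - 1) - (z * G z - 1) * (w * G w)
     - (w * G w - 1)) / ((z * G z) * (w * G w))).
  have -> : (G z)^-1 - z - ((G w)^-1 - w) = (G w - G z) / (G z * G w) - (z - w).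
    by field; apply/andP; split.
  rewrite GB; field.
  by rewrite zn0 wn0 Gz0 Gw0.
rewrite Normc.normcM mulrC ler_wpM2r ?normc_ge0// Normc.normcM Normc.normcV.
have q0 : 9 / 16 <= N (z * G z * (w * G w)).
  rewrite Normc.normcM; have := ler_pM _ _ zc wc; lra.
rewrite ler_pdivrMr; last by move: q0; lra.
have wu : N (w * G w) <= 5 / 4.
  have := normc_triangle (w * G w) 0 1; rewrite !subr0 Normc.normc1.
  by move: hw d4; lra.
have num : N (z * w * D - 1 - (z * G z - 1) * (w * G w) - (w * G w - 1)) <=
    d + d * (5 / 4) + d.
  apply: le_trans (normcB _ _) _; apply: lerD => //.
  apply: le_trans (normcB _ _) _; apply: lerD => //.
  by rewrite Normc.normcM; apply: ler_pM => //; exact: normc_ge0.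
apply: (le_trans num).
have : e * (9 / 16) <= e * N (z * G z * (w * G w)) by rewrite ler_wpM2l// ltW.
move: d8 d0; lra.
Qed.

End ComplexMeans.

(** * Perturbations of the identity on cones *)

Section NearIdentityMaps.
Context {R : realType}.
Local Open Scope complex_scope.
Implicit Types (z w u v : R[i]) (f : R[i] -> R[i]).
Local Notation N := Normc.normc.

Lemma near_identity_scale (c : R) f : near_identity f ->
  near_identity (fun z => z + c%:C * (f z - z)).
Proof.
move=> nf a e a0 e0.
have c1 : 0 < 1 + `|c| by rewrite ltr_pwDl.
have [b b0 h] := nf a (e / (1 + `|c|)) a0 (divr_gt0 e0 c1).
have ce x : 0 <= x -> `|c| * (e / (1 + `|c|) * x) <= e * x.
  move=> x0; rewrite mulrA ler_wpM2r// mulrCA ler_piMr// ?(ltW e0)//.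
  by rewrite ler_pdivrMr// mul1r lerDr.
exists b => // z w cz cw; have [h1 h2] := h _ _ cz cw.
have E u : u + c%:C * (f u - u) - u = c%:C * (f u - u) by ring.
rewrite !E -mulrBr !Normc.normcM normc_real; split.
  by apply: le_trans (ce _ (normc_ge0 _)); rewrite ler_wpM2l.
by apply: le_trans (ce _ (normc_ge0 _)); rewrite ler_wpM2l.
Qed.

Lemma truncated_coneS (a a' b b' : R) : a' <= a -> b <= b' -> 0 <= b ->
  truncated_cone a' b' `<=` truncated_cone a b.
Proof.
move=> aa bb b0 z [h1 h2]; have z0 : b < complex.Im z by exact: le_lt_trans h2.
split=> //; apply: (lt_le_trans h1); rewrite ler_wpM2r// ltW//.
exact: le_lt_trans z0.
Qed.

Lemma cone_perturb (a' a : R) : 0 < a' -> a' < a -> exists2 r : R, 0 < r <= 2^-1 &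
  forall b u v, 0 <= b -> truncated_cone a' b v -> N (u - v) <= r * N v ->
    truncated_cone a (b / 2) u.
Proof.
move=> a'0 aa.
have h1 : 0 < (a - a') / (1 + a) by rewrite divr_gt0//; lra.
(* q <= 1/2 keeps half of the height; q (1 + a) <= a - a' is the inequality a' + q <= a (1 - q),
   which gives the aperture a. *)
pose q := Num.min (2^-1) ((a - a') / (1 + a)).
have q0 : 0 < q by rewrite lt_min invr_gt0 ltr0n.
have q2 : q <= 2^-1 by rewrite ge_min lexx.
have qa : q * (1 + a) <= a - a'.
  by rewrite -ler_pdivlMr; [rewrite ge_min lexx orbT|lra].
exists (q / (1 + a')).
  rewrite divr_gt0 ?ler_pdivrMr//=; [|lra|lra].
  apply: (le_trans q2); rewrite ler_peMr ?invr_ge0 ?ler0n//; lra.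
move=> b u v b0 cv uv; have [v0 Nv] := normc_cone b0 cv.
have {}uv : N (u - v) <= q * complex.Im v.
  apply: (le_trans uv); rewrite -mulrA ler_wpM2l// ?(ltW q0)//.
  by rewrite mulrC ler_pdivrMr 1?mulrC//; lra.
have := le_trans (normc_ge_normRe _) uv; have := le_trans (normc_ge_normIm _) uv.
rewrite ReB ImB => /[swap]; case: cv => h2 h3.
have := lerB_dist (complex.Re u) (complex.Re v).
set ru := `|complex.Re u| in h2 *; set rv := `|complex.Re v| in h2 *.
set k := `|_ - _| => k1 k2; rewrite ler_norml => /andP[h4 _].
have Iu : (1 - q) * complex.Im v <= complex.Im u by lra.
split; last by nra.
rewrite -/ru.
have : ru < (a' + q) * complex.Im v by lra.
have : (a' + q) * complex.Im v <= a * ((1 - q) * complex.Im v).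
  by rewrite mulrA ler_wpM2r ?(ltW v0)//; lra.
have : a * ((1 - q) * complex.Im v) <= a * complex.Im u.
  by rewrite ler_wpM2l//; lra.
lra.
Qed.

Lemma near_identity_maps f (a' a b : R) : near_identity f ->
  0 < a' -> a' < a -> 0 < b ->
  exists2 b', 0 < b' & forall z, truncated_cone a' b' z -> truncated_cone a b (f z).
Proof.
move=> nf a'0 aa b0; have [r /andP[r0 _] hr] := cone_perturb a'0 aa.
have [b1 b10 h] := nf a' r a'0 r0.
exists (Num.max b1 (2 * b)); first by rewrite lt_max b10.
move=> z cz.
have c1 : truncated_cone a' b1 z.
  by apply: truncated_coneS cz; rewrite ?lexx ?le_max ?lexx// ltW.
have [hz _] := h _ _ c1 c1.
have m0 : 0 <= Num.max b1 (2 * b) by rewrite le_max (ltW b10).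
have := hr _ _ _ m0 cz hz.
apply: truncated_coneS => //; last exact: ltW.
by rewrite ler_pdivlMr// mulrC le_max lexx orbT.
Qed.

Lemma near_identity_inj f (a : R) : near_identity f -> 0 < a ->
  exists2 b, 0 < b & forall b', b <= b' -> set_inj (truncated_cone a b') f.
Proof.
move=> nf a0; have e0 : 0 < 2^-1 :> R by rewrite invr_gt0 ltr0n.
have [b b0 h] := nf a _ a0 e0.
exists b => // b' bb z w /set_mem cz /set_mem cw fzw.
have cz' : truncated_cone a b z by apply: truncated_coneS cz; rewrite ?lexx// ltW.
have cw' : truncated_cone a b w by apply: truncated_coneS cw; rewrite ?lexx// ltW.
have [_] := h _ _ cz' cw'; rewrite fzw.
rewrite (_ : _ - (_ - w) = w - z); last by ring.
rewrite normc_distC => hn.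
apply/eqP; rewrite -subr_eq0; apply/eqP/Normc.eq0_normc.
have := normc_ge0 (z - w); move: hn; lra.
Qed.

Lemma cvgn_geometric_increments (u : R^nat) (C : R) :
  (forall n, `|u n.+1 - u n| <= C * 2^-1 ^+ n) -> cvgn u.
Proof.
move=> h; rewrite (_ : u = fun n => u 0%N + series (telescope u) n); last first.
  by apply/funext => n; exact: eq_sum_telescope.
apply: is_cvgD; first exact: is_cvg_cst.
apply: normed_cvg; apply: (@series_le_cvg _ _ (geometric C 2^-1)).
- by move=> n; rewrite normr_ge0.
- by move=> n; rewrite /geometric/= (le_trans _ (h n)).
- by move=> n; exact: h.
apply: is_cvg_geometric_series.
by rewrite ger0_norm ?invr_ge0 ?ler0n// invf_lt1// ltr1n.
Qed.

Lemma complex_cauchy_limit (z : nat -> R[i]) (C : R) :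
  (forall n, N (z n.+1 - z n) <= C * 2^-1 ^+ n) ->
  exists l, forall e, 0 < e -> \forall n \near \oo, N (z n - l) <= e.
Proof.
move=> h.
have cR : cvgn (fun n => complex.Re (z n)).
  apply: (@cvgn_geometric_increments _ C) => n.
  by rewrite -ReB (le_trans (normc_ge_normRe _)).
have cI : cvgn (fun n => complex.Im (z n)).
  apply: (@cvgn_geometric_increments _ C) => n.
  by rewrite -ImB (le_trans (normc_ge_normIm _)).
exists (lim (complex.Re (z n) @[n --> \oo]) +i* lim (complex.Im (z n) @[n --> \oo])).
move=> e e0; have e2 : 0 < e / 2 by rewrite divr_gt0.
move/cvgrPdist_le : cR => /(_ _ e2) hR; move/cvgrPdist_le : cI => /(_ _ e2) hI.
near=> n; apply: le_trans (normc_le_Re_Im _) _; rewrite ReB ImB /=.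
rewrite (splitr e); apply: lerD; rewrite distrC; near: n; [exact: hR|exact: hI].
Unshelve. all: by end_near. Qed.

(** A solution of f z = v is a fixed point of z |-> v - (f z - z). The iteration starts at v and
    stays within r |v| of it, a ball that [cone_perturb] keeps inside the larger cone. *)
Lemma near_identity_surj f (a' a b : R) : near_identity f ->
  0 < a' -> a' < a -> 0 < b ->
  exists2 b', 0 < b' & forall v, truncated_cone a' b' v ->
    exists2 z, truncated_cone a b z & f z = v.
Proof.
move=> nf a'0 aa b0; have [r /andP[r0 r2] hr] := cone_perturb a'0 aa.
have a0 : 0 < a by exact: lt_trans aa.
(* r / 2 serves twice: as |z| <= 2 |v| on the ball, the image lies within r |v| of v again, and it
   is a contraction constant below 1/2. *)
have e0 : 0 < r / 2 by rewrite divr_gt0.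
have [b1 b10 h] := nf a (r / 2) a0 e0.
pose m := Num.max b b1.
have m0 : 0 < m by rewrite lt_max b0.
(* Doubled because [cone_perturb] halves the height. *)
exists (2 * m) => [|v cv]; first by rewrite mulr_gt0.
pose g z := f z - z.
have ball u : N (u - v) <= r * N v -> truncated_cone a b u /\ truncated_cone a b1 u.
  move=> hu; have := hr (2 * m) u v _ cv hu.
  rewrite (_ : 2 * m / 2 = m); last by field.
  have m20 : 0 <= 2 * m by rewrite mulr_ge0// ltW.
  move=> /(_ m20).
  by move=> cu; split; apply: truncated_coneS cu;
    rewrite ?lexx ?le_max ?lexx ?orbT// ltW.
pose z n := iter n (fun z => v - g z) v.
have zS n : z n.+1 = v - g (z n) by [].
have zball n : N (z n - v) <= r * N v.
  elim: n => [|n IH]; first by rewrite subrr Normc.normc0 mulr_ge0 ?normc_ge0 ?ltW.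
  have [_ cz] := ball _ IH; have [hz _] := h _ _ cz cz.
  rewrite zS addrAC subrr add0r normcN; apply: (le_trans hz).
  have := normc_triangle (z n) 0 v; rewrite !subr0 => tz.
  have rv : r * N v <= 2^-1 * N v by rewrite ler_wpM2r// normc_ge0.
  have : r / 2 * N (z n) <= r / 2 * (2 * N v).
    by rewrite ler_wpM2l ?(ltW e0)//; have := normc_ge0 v; move: IH tz rv; lra.
  lra.
pose C := N (z 1%N - z 0%N).
have incr n : N (z n.+1 - z n) <= C * 2^-1 ^+ n.
  elim: n => [|n IH]; first by rewrite mulr1.
  have [_ c1] := ball _ (zball n.+1); have [_ c2] := ball _ (zball n).
  have [_ hz] := h _ _ c2 c1.
  have -> : z n.+2 - z n.+1 = g (z n) - g (z n.+1).
    transitivity ((v - g (z n.+1)) - (v - g (z n))); first by [].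
    by ring.
  apply: (le_trans hz); rewrite normc_distC exprS mulrCA; apply: ler_pM => //.
  - exact: ltW.
  - exact: normc_ge0.
  - by move: r2; lra.
have [l hl] := complex_cauchy_limit incr.
have lball : N (l - v) <= r * N v.
  apply/ler_addgt0Pr => d d0; have [n _ /(_ n (leqnn n))/= hn] := hl _ d0.
  have := normc_triangle l v (z n); rewrite (normc_distC l (z n)).
  have := zball n; move: hn; lra.
have [cl cl1] := ball _ lball.
exists l => //; apply/eqP; rewrite -subr_eq0; apply/eqP/Normc.eq0_normc.
apply/eqP; rewrite eq_le normc_ge0 andbT; apply/ler_addgt0Pr => e e'0.
rewrite add0r; have e2 : 0 < e / 2 by rewrite divr_gt0.
have : \forall n \near \oo, N (z n - l) <= e / 2 /\ N (z n.+1 - l) <= e / 2.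
  near=> n; split; near: n; first exact: hl.
  have [n0 _ hn0] := hl _ e2; exists n0 => // n /= n0n.
  by apply: (hn0 n.+1) => /=; exact: leqW.
move=> [n _ /(_ n (leqnn n))[hn1 hn2]].
have [_ c2] := ball _ (zball n).
have [_ hz] := h _ _ cl1 c2.
have -> : f l - v = (g l - g (z n)) + (l - z n.+1).
  by rewrite zS /g; ring.
apply: le_trans (le_normcD _ _) _; rewrite (splitr e); apply: lerD.
  apply: (le_trans hz); rewrite normc_distC -[leRHS]mul1r.
  apply: ler_pM => //; [exact: ltW|exact: normc_ge0|].
  by move: r2; lra.
by rewrite normc_distC.
Unshelve. all: by end_near. Qed.

End NearIdentityMaps.

(** * Density of resolvents *)

Section Density.
Context {R : realType}.
Local Open Scope complex_scope.
Implicit Types (z w : R[i]) (f g : R -> R).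
Local Notation N := Normc.normc.

(** Covers two cases at once: the functions on which two means agree, and those along which a
    sequence of means converges. *)
Definition uniformly_closed (V : (R -> R) -> Prop) :=
  (forall (a : R) f g, V f -> V g -> V (fun x => a * f x + g x)) /\
  (forall f, Cb f ->
     (forall e : R, 0 < e -> exists2 g, V g & forall x, `|f x - g x| <= e) ->
     V f).

Section UniformlyClosed.
Variables (V : (R -> R) -> Prop) (hV : uniformly_closed V).

Lemma ucl_linear (a : R) f g : V f -> V g -> V (fun x => a * f x + g x).
Proof. by case: hV => h _; exact: h. Qed.

Lemma ucl0 f : V f -> V (fun=> 0).
Proof.
move=> Vf; rewrite (_ : (fun=> 0) = (fun x => (-1) * f x + f x)).
  exact: ucl_linear.
by apply/funext => x; rewrite mulN1r addNr.
Qed.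

Lemma uclZ (a : R) f : V f -> V (fun x => a * f x).
Proof.
move=> Vf; rewrite (_ : (fun x => _) = (fun x => a * f x + 0)).
  by apply: ucl_linear => //; exact: ucl0 Vf.
by apply/funext => x; rewrite addr0.
Qed.

Lemma uclD f g : V f -> V g -> V (fun x => f x + g x).
Proof.
move=> Vf Vg; rewrite (_ : (fun x => _) = (fun x => 1 * f x + g x)).
  exact: ucl_linear.
by apply/funext => x; rewrite mul1r.
Qed.

Lemma uclB f g : V f -> V g -> V (fun x => f x - g x).
Proof.
move=> Vf Vg; rewrite (_ : (fun x => _) = (fun x => -1 * g x + f x)).
  exact: ucl_linear.
by apply/funext => x; rewrite mulN1r addrC.
Qed.

Lemma ucl_sum f (n : nat) (h : 'I_n -> R -> R) : V f -> (forall i, V (h i)) ->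
  V (fun x => \sum_(i < n) h i x).
Proof.
move=> Vf; elim: n h => [|n IH] h Vh.
  rewrite (_ : (fun x => _) = (fun=> 0)); first exact: ucl0 Vf.
  by apply/funext => x; rewrite big_ord0.
rewrite (_ : (fun x => _) =
    (fun x => \sum_(i < n) h (widen_ord (leqnSn n) i) x + h ord_max x)).
  by apply: uclD; [exact: IH|exact: Vh].
by apply/funext => x; rewrite big_ord_recr.
Qed.

Definition complexified (phi : R -> R[i]) :=
  V (fun x => complex.Re (phi x)) /\ V (fun x => complex.Im (phi x)).
Local Notation VC := complexified.

Lemma complexifiedD phi psi : VC phi -> VC psi -> VC (fun x => phi x + psi x).
Proof.
move=> [h1 h2] [h3 h4]; split.
  by under [X in V X]funext do rewrite ReD; exact: uclD.
by under [X in V X]funext do rewrite ImD; exact: uclD.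
Qed.

Lemma complexifiedB phi psi : VC phi -> VC psi -> VC (fun x => phi x - psi x).
Proof.
move=> [h1 h2] [h3 h4]; split.
  by under [X in V X]funext do rewrite ReB; exact: uclB.
by under [X in V X]funext do rewrite ImB; exact: uclB.
Qed.

Lemma complexifiedZ z phi : VC phi -> VC (fun x => z * phi x).
Proof.
move=> [h1 h2]; split.
  by under [X in V X]funext do rewrite ReM; apply: uclB; exact: uclZ.
by under [X in V X]funext do rewrite ImM; apply: uclD; exact: uclZ.
Qed.

Lemma complexified_closed phi : CbC phi ->
  (forall e : R, 0 < e -> exists2 psi, VC psi & forall x, N (phi x - psi x) <= e) ->
  VC phi.
Proof.
move=> [c1 c2] h; split; apply: hV.2 => // e /h[psi [V1 V2] hpsi].
  exists (fun x => complex.Re (psi x)) => // x; rewrite -ReB.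
  exact: le_trans (normc_ge_normRe _) (hpsi x).
exists (fun x => complex.Im (psi x)) => // x; rewrite -ImB.
exact: le_trans (normc_ge_normIm _) (hpsi x).
Qed.

(* Partial fractions in x: the difference of the resolvent and of the product
   is a combination of the resolvents at the poles [p k]. *)
Lemma complexified_partial_fractions (p : nat -> R[i]) (n : nat) z :
  injective p -> (forall k, 0 < complex.Im (p k)) ->
  (forall k, VC (resolvent (p k))) -> 0 < complex.Im z ->
  VC (fun x => resolvent z x -
    resolvent z x * \prod_(k < n) ((p k - z) * resolvent (p k) x)).
Proof.
move=> pI p0 pV; elim: n z => [|n IH] z z0.
  rewrite (_ : (fun x => _) = (fun x => 0 * resolvent (p 0%N) x)).
    exact: complexifiedZ.
  by apply/funext => x; rewrite big_ord0 mulr1 subrr mul0r.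
(* By the resolvent identity the new factor adds [resolvent (p n)] times the old product; c turns
   the factors p k - p n into p k - z, so that the induction hypothesis at p n handles this term. *)
pose c := \prod_(k < n) ((p k - z) / (p k - p n)).
rewrite (_ : (fun x => _) = (fun x => (resolvent z x -
    resolvent z x * \prod_(k < n) ((p k - z) * resolvent (p k) x)) +
    c * (resolvent (p n) x - (resolvent (p n) x - resolvent (p n) x *
      \prod_(k < n) ((p k - p n) * resolvent (p k) x))))); last first.
  apply/funext => x; rewrite big_ord_recr /= subKr.
  rewrite (_ : c * _ = resolvent (p n) x *
      \prod_(k < n) ((p k - z) * resolvent (p k) x)); last first.
    rewrite mulrCA /c -big_split/=; congr (_ * _); apply: eq_bigr => k _.
    rewrite mulrA mulrVK// unitfE subr_eq0; apply/eqP => /pI e.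
    by have := ltn_ord k; rewrite e ltnn.
  rewrite -addrA; congr (_ + _).
  set P := \prod_(_ < _) _.
  have := subr_real_neq0 x z0; have := subr_real_neq0 x (p0 n).
  by rewrite /resolvent => ? ?; field; apply/andP; split.
apply: complexifiedD; first exact: IH.
by apply: complexifiedZ; apply: complexifiedB => //; exact: IH.
Qed.

(** For real x, |(i y - z) / (i y - x)| <= |i y - z| / y, and |i y - z|^2 = y^2 - 2 y Im z + |z|^2
    <= y^2 - y Im z as soon as y >= |z|^2 / Im z. Each high pole thus multiplies the remainder by a
    factor below 1, uniformly in x. *)
Lemma complexified_resolvent (b : R) : 0 < b ->
  (forall y, b < y -> VC (resolvent (0 +i* y))) ->
  forall z, 0 < complex.Im z -> VC (resolvent z).
Proof.
move=> b0 hb z z0; pose Y := Num.max b (N z ^+ 2 / complex.Im z).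
have Y0 : 0 < Y by rewrite lt_max b0.
(* Distinct, as partial fractions require, yet bounded, so that all factors share one rate q < 1. *)
pose y k : R := Y + k.+1%:R^-1.
have yY k : Y < y k by rewrite ltrDl invr_gt0 ltr0n.
have yY1 k : y k <= Y + 1 by rewrite lerD2l invf_le1 ?ler1n ?ltr0n.
pose p k := 0 +i* y k : R[i].
have pI : injective p.
  by move=> i j [] /addrI/invr_inj/eqP; rewrite eqr_nat eqSS => /eqP.
have p0 k : 0 < complex.Im (p k) by exact: lt_trans (yY k).
have pV k : VC (resolvent (p k)).
  by apply: hb; apply: le_lt_trans (yY k); rewrite le_max lexx.
have Y1 : 0 < Y + 1 by rewrite addr_gt0.
(* Then y_k t <= Im z for all k, whence |p_k - z|^2 <= (1 - t) y_k^2 <= (q y_k)^2 with q = 1 - t /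
   2. *)
pose t := complex.Im z / (Y + 1).
have t0 : 0 < t by rewrite divr_gt0.
have Iz : complex.Im z <= Y.
  rewrite le_max; apply/orP; right; rewrite ler_pdivlMr// -expr2.
  rewrite ler_sqr ?nnegrE ?normc_ge0 ?(ltW z0)//; exact: normc_ge_Im.
have t1 : t <= 1 by rewrite ler_pdivrMr// mul1r (le_trans Iz)// lerDl.
pose q := 1 - t / 2.
have q0 : 0 <= q by rewrite /q; move: t1; lra.
have q1 : q < 1 by rewrite /q; move: t0; lra.
have pq k x : N ((p k - z) * resolvent (p k) x) <= q.
  have yk0 : 0 < y k by exact: lt_trans (yY k).
  rewrite Normc.normcM; apply: (@le_trans _ _ (q * y k * (y k)^-1)); last first.
    by rewrite mulfK// gt_eqF.
  apply: ler_pM; rewrite ?normc_ge0//; last exact: normc_resolvent_le.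
  rewrite -ler_sqr ?nnegrE ?normc_ge0 ?mulr_ge0 ?(ltW yk0)//.
  rewrite sqr_normc_Re_Im ReB ImB /= sub0r.
  have zz : N z ^+ 2 <= y k * complex.Im z.
    by rewrite -ler_pdivrMr// (le_trans _ (ltW (yY k)))// le_max lexx orbT.
  rewrite sqr_normc_Re_Im in zz.
  have ty : y k * t <= complex.Im z.
    rewrite /t mulrA ler_pdivrMr// mulrC ler_wpM2l ?(ltW z0)//.
  have : (1 - t) * (y k * y k) <= (q * y k) ^+ 2.
    rewrite exprMn -expr2 ler_wpM2r ?sqr_ge0// /q.
    have := sqr_ge0 (t / 2); rewrite !expr2; lra.
  have : y k * (y k * t) <= y k * complex.Im z by rewrite ler_wpM2l// ltW.
  move: zz; rewrite !expr2; lra.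
apply: complexified_closed; first exact: CbC_resolvent.
move=> e e0.
have := @cvg_expr R q; rewrite ger0_norm// => /(_ q1).
move=> /cvgrPdist_le/(_ _ (mulr_gt0 e0 z0))[n _ /(_ n (leqnn n))].
rewrite /= sub0r normrN ger0_norm ?exprn_ge0// => qn.
exists (fun x => resolvent z x -
  resolvent z x * \prod_(k < n) ((p k - z) * resolvent (p k) x)).
  exact: complexified_partial_fractions.
move=> x; rewrite subKr Normc.normcM.
have : N (\prod_(k < n) ((p k - z) * resolvent (p k) x)) <= q ^+ n.
  elim: (n) => [|m IH]; first by rewrite big_ord0 Normc.normc1.
  rewrite big_ord_recr/= Normc.normcM exprSr; apply: ler_pM => //;
    exact: normc_ge0.
have h : N (resolvent z x) <= (complex.Im z)^-1 by exact: normc_resolvent_le.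
move=> /(ler_pM (normc_ge0 _) (normc_ge0 _) h)/le_trans; apply.
by rewrite mulrC ler_pdivrMr.
Qed.

Lemma ucl_poisson (b : R) : 0 < b ->
  (forall y, b < y -> VC (resolvent (0 +i* y))) ->
  forall u y : R, 0 < y -> V (fun x => y / (y ^+ 2 + (u - x) ^+ 2)).
Proof.
move=> b0 hb u y y0.
have [_] := @complexified_resolvent _ b0 hb (u +i* y) y0.
move=> /(uclZ (-1)); congr V; apply/funext => x.
rewrite ImV sqr_normc_Re_Im Re_subr_real Im_subr_real/= mulN1r opprK.
by rewrite addrC.
Qed.

Lemma poisson_lipschitz (y u v : R) : 0 < y ->
  `|y / (y ^+ 2 + u ^+ 2) - y / (y ^+ 2 + v ^+ 2)| <= `|u - v| / y ^+ 2.
Proof.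
move=> y0; have y20 : 0 < y ^+ 2 by rewrite exprn_gt0.
set A := y ^+ 2 + u ^+ 2; set B := y ^+ 2 + v ^+ 2.
have A0 : 0 < A by rewrite ltr_pwDl// sqr_ge0.
have B0 : 0 < B by rewrite ltr_pwDl// sqr_ge0.
have -> : y / A - y / B = (v - u) * (y * (u + v) / (A * B)).
  rewrite /A /B in A0 B0 *; field.
  by apply/andP; split; rewrite gt_eqF.
rewrite normrM distrC ler_wpM2l//.
rewrite normrM normfV (gtr0_norm (mulr_gt0 A0 B0)) ler_pdivrMr ?mulr_gt0//.
rewrite normrM (gtr0_norm y0).
have h1 : 2 * (y * `|u|) <= A.
  have := sqr_ge0 (y - `|u|); rewrite /A -(real_normK (num_real u)) !expr2; nra.
have h2 : 2 * (y * `|v|) <= B.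
  have := sqr_ge0 (y - `|v|); rewrite /B -(real_normK (num_real v)) !expr2; nra.
have yA : y ^+ 2 <= A by rewrite lerDl sqr_ge0.
have yB : y ^+ 2 <= B by rewrite lerDl sqr_ge0.
rewrite [leRHS]mulrC ler_pdivlMr//.
have : y * `|u + v| <= y * `|u| + y * `|v|.
  by rewrite -mulrDr ler_wpM2l ?(ltW y0)// ler_normD.
nra.
Qed.

(** The Poisson kernel is the derivative of the arctangent in its base point. The error is quadratic
    in h, so it still vanishes after summing over n cells of width of order 1 / n. *)
Lemma atan_increment (y a h x : R) : 0 < y -> 0 < h ->
  `|atan ((a + h - x) / y) - atan ((a - x) / y) -
    h * (y / (y ^+ 2 + (a - x) ^+ 2))| <= h ^+ 2 / y ^+ 2.
Proof.
move=> y0 h0.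
have dF u : is_derive u (1 : R) (fun u => atan ((u - x) / y))
    (y / (y ^+ 2 + (u - x) ^+ 2)).
  have H : is_derive u (1 : R) (fun u : R => (u - x) / y) y^-1.
    by apply: is_derive_eq; rewrite scaler0 add0r subr0 /GRing.scale/= mulr1.
  have K := @is_derive1_comp R atan (fun u : R => (u - x) / y) u _ _
    (is_derive1_atan _) H.
  apply: (is_derive_eq K); field.
  by rewrite !gt_eqF// ltr_pwDl ?sqr_ge0// exprn_gt0.
have [c] : exists2 c, c \in `]a, (a + h)[ &
    atan ((a + h - x) / y) - atan ((a - x) / y) =
    y / (y ^+ 2 + (c - x) ^+ 2) * (a + h - a).
  apply: (@MVT R (fun u => atan ((u - x) / y))
     (fun u => y / (y ^+ 2 + (u - x) ^+ 2)) a (a + h)).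
  - by rewrite ltrDl.
  - apply: derivable_within_continuous => u _.
    exact: (@ex_derive _ _ _ _ _ _ _ (dF u)).
rewrite in_itv/= => /andP[ac ch] E; rewrite E => {E}.
rewrite [a + h - a]addrAC subrr add0r [h * _]mulrC -mulrBl normrM (gtr0_norm h0).
rewrite expr2 -mulrA [h * (h / _)]mulrC ler_wpM2r ?(ltW h0)//.
apply: le_trans (poisson_lipschitz _ _ y0) _.
rewrite ler_wpM2r ?invr_ge0 ?sqr_ge0//.
rewrite opprB addrA subrK gtr0_norm ?subr_gt0//.
by move: ch; lra.
Qed.

Lemma ucl_atan (y a b : R) : 0 < y -> a <= b ->
  (forall u, V (fun x => y / (y ^+ 2 + (u - x) ^+ 2))) ->
  V (fun x => atan ((b - x) / y) - atan ((a - x) / y)).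
Proof.
move=> y0 + hP; rewrite le_eqVlt => /predU1P[->|ab].
  rewrite (_ : (fun x => _) = (fun=> 0)); first exact: ucl0 (hP 0).
  by apply/funext => x; rewrite subrr.
have Cat c : Cb (fun x => atan ((c - x) / y)).
  split.
    move=> x; apply: (@continuous_comp _ _ _ (fun x => (c - x) / y) (@atan R)).
      apply: cvgM; last exact: cvg_cst.
      by apply: cvgB; [exact: cvg_cst|exact: cvg_id].
    exact: continuous_atan.
  exists (pi / 2) => x; rewrite ler_norml ltW ?atan_gtNpi2//=.
  by rewrite ltW// atan_ltpi2.
apply: hV.2; first by apply: CbB; exact: Cat.
move=> e e0; have ba0 : 0 < b - a by rewrite subr_gt0.
have y20 : 0 < y ^+ 2 by rewrite exprn_gt0.
(* The total error n h^2 / y^2 is (b - a)^2 / (n y^2). *)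
pose n := (Num.truncn ((b - a) ^+ 2 / (e * y ^+ 2))).+1.
have n0 : 0 < n%:R :> R by rewrite ltr0n.
have hn : (b - a) ^+ 2 / (e * y ^+ 2) <= n%:R by rewrite ltW// truncnS_gt.
pose h := (b - a) / n%:R.
have h0 : 0 < h by rewrite divr_gt0.
exists (fun x => \sum_(i < n) h * (y / (y ^+ 2 + ((a + i%:R * h) - x) ^+ 2))).
  apply: (@ucl_sum _ n (fun i x =>
    h * (y / (y ^+ 2 + ((a + i%:R * h) - x) ^+ 2))) (hP 0)) => i.
  exact: uclZ.
move=> x; pose u i : R := atan ((a + i%:R * h - x) / y).
have -> : atan ((b - x) / y) - atan ((a - x) / y) =
    \sum_(i < n) (u i.+1 - u i).
  rewrite -(big_mkord xpredT (fun i => u i.+1 - u i)) telescope_sumr//.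
  have nh : a + n%:R * h = b by rewrite /h mulrC divfK ?gt_eqF// addrC subrK.
  by rewrite /u mul0r addr0 nh.
rewrite -sumrB; apply: le_trans (ler_norm_sum _ _ _) _.
apply: (@le_trans _ _ (\sum_(i < n) h ^+ 2 / y ^+ 2)).
  apply: ler_sum => i _; rewrite /u.
  have -> : a + i.+1%:R * h = a + i%:R * h + h.
    by rewrite -natr1 mulrDl mul1r addrA.
  exact: atan_increment.
rewrite sumr_const card_ord -mulr_natl.
have -> : n%:R * (h ^+ 2 / y ^+ 2) = (b - a) ^+ 2 / (e * y ^+ 2) / n%:R * e.
  by rewrite /h; field; rewrite !gt_eqF.
by rewrite ler_piMl ?(ltW e0)// ler_pdivrMr// mul1r.
Qed.

(** Two families are used: rescaled arctangents, reached from resolvents, and complements of ramps,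
    on which two means can be compared directly. *)
Definition sigmoid (s : R -> R -> R) (d e : R) :=
  [/\ forall a x, 0 <= s a x <= 1,
     forall a a' x, a <= a' -> s a' x <= s a x,
     forall a x, a + d <= x -> 1 - e <= s a x &
     forall a x, x <= a - d -> s a x <= e].

Lemma compact_support_unif_continuous f (M e : R) : continuous f ->
  (forall x, M < `|x| -> f x = 0) -> 0 < e ->
  exists2 d, 0 < d & forall x u, `|u - x| < d -> `|f u - f x| <= e.
Proof.
move=> cf f0 e0; have e2 : 0 < e / 2 by rewrite divr_gt0.
have cK : compact `[(- (M + 1)), (M + 1)]%classic by exact: segment_compact.
have /compact_near_coveringP/(_ R (0^'+) (fun d x =>
   forall u, `|u - x| < d -> `|f u - f x| <= e)) := cK.
case.
  move=> x _.
  have /cvgrPdist_le/(_ _ e2) := cf x.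
  move=> /nbhs_ballP[r /= r0 hr].
  have r2 : 0 < r / 2 by rewrite divr_gt0.
  exists (ball x (r / 2), [set d | d < r / 2]).
    split=> /=; first exact: nbhsx_ballx.
    exact: nbhs_right_lt.
  move=> [x' d] /= [bx dr] u ud.
  have h1 : `|f x - f x'| <= e / 2.
    by apply: hr; apply: lt_le_trans bx _; rewrite ler_pdivrMr// ler_pMr// ler1n.
  have h2 : `|f x - f u| <= e / 2.
    apply: hr; rewrite /ball/= -(subrK x' x) -addrA.
    apply: (le_lt_trans (ler_normD _ _)); rewrite (splitr r) ltrD//.
    by rewrite distrC; exact: lt_trans dr.
  have -> : f u - f x' = (f x - f x') - (f x - f u) by ring.
  by rewrite (le_trans (ler_normB _ _))// (splitr e) lerD.
move=> d0 /= d00 hd.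
(* The bound 1 ensures that a point u near some x with |x| > M + 1 is itself outside the support. *)
pose d := Num.min (d0 / 2) 1.
have d_gt0 : 0 < d by rewrite lt_min divr_gt0//=.
exists d => // x u ux.
have [xM|Mx] := leP `|x| (M + 1).
  apply: (hd (d0 / 2)) => /=.
  - by rewrite sub0r normrN gtr0_norm ?divr_gt0// ltr_pdivrMr// ltr_pMr// ltr1n.
  - by rewrite divr_gt0.
  - by rewrite in_itv/= -ler_norml.
  - by apply: (lt_le_trans ux); rewrite ge_min lexx.
rewrite !f0 ?subrr ?normr0 ?(ltW e0)//; first by move: Mx; lra.
have := ler_normB u (u - x); rewrite subKr => h.
have : `|u - x| < 1 by apply: (lt_le_trans ux); rewrite ge_min lexx orbT.
by move: h Mx; lra.
Qed.

(* Riemann-Stieltjes sums of f against a steep sigmoid: the cells far from x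
   carry total weight at most 2 e because s a x is there within e of 0 or 1. *)
Lemma ucl_compact_support f (M : R) :
  (forall d e, 0 < d -> 0 < e -> exists2 s, sigmoid s d e &
     forall a b, a <= b -> V (fun x => s a x - s b x)) ->
  Cb f -> (forall x, M < `|x| -> f x = 0) -> V f.
Proof.
move=> hs cf f0; apply: hV.2 => // e0 e00.
have e_gt0 : 0 < e0 / 2 by rewrite divr_gt0.
set e := e0 / 2 in e_gt0; have [cont [B0 hB0]] := cf.
pose B := Num.max B0 1.
have hB x : `|f x| <= B by rewrite le_max hB0.
have B1 : 1 <= B by rewrite le_max lexx orbT.
have [r r0 hr] := compact_support_unif_continuous cont f0 e_gt0.
pose M' := Num.max M 0.
have M'0 : 0 <= M' by rewrite le_max lexx orbT.
have {}f0 x : M' < `|x| -> f x = 0.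
  by move=> h; apply: f0; apply: le_lt_trans h; rewrite le_max lexx.
(* Width and mesh are both at most r / 2, so both nodes of a cell with |x - a_i| >= r are at
   distance at least d from x; d <= 1 fits the margin between M' and L. *)
pose d := Num.min (r / 2) 1.
have d0 : 0 < d by rewrite lt_min divr_gt0//=.
have dr : d <= r / 2 by rewrite ge_min lexx.
have d1 : d <= 1 by rewrite ge_min lexx orbT.
have B60 : 0 < 6 * B by move: B1; lra.
(* The errors add up to 2 B t + (e + 4 B t) <= 2 e = e0. *)
pose t := Num.min (2^-1) (e / (6 * B)).
have t0 : 0 < t by rewrite lt_min; apply/andP; split; lra || exact: divr_gt0.
have t2 : t <= 2^-1 by rewrite ge_min lexx.
have tB : 6 * B * t <= e by rewrite mulrC -ler_pdivlMr// ge_min lexx orbT.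
have [s [s01 smono shi slo] Vs] := hs d t d0 t0.
pose L := M' + 1.
have L0 : 0 < L by rewrite /L; lra.
pose n := (Num.truncn (2 * L / (r / 2))).+1.
have n0 : 0 < n%:R :> R by rewrite ltr0n.
have hn : 2 * L / (r / 2) <= n%:R by rewrite ltW// truncnS_gt.
pose h := 2 * L / n%:R.
have h0 : 0 < h by rewrite divr_gt0// mulr_gt0.
have hr2 : h <= r / 2.
  have r20 : 0 < r / 2 by rewrite divr_gt0.
  by rewrite ler_pdivrMr// [leRHS]mulrC -ler_pdivrMr.
pose a i : R := - L + i%:R * h.
have aS i : a i.+1 = a i + h by rewrite /a -natr1 mulrDl mul1r addrA.
have aleS i : a i <= a i.+1 by rewrite aS lerDl ltW.
exists (fun x => \sum_(i < n) f (a i) * (s (a i) x - s (a i.+1) x)).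
  apply: (@ucl_sum _ n (fun i x => f (a i) * (s (a i) x - s (a i.+1) x))
    (Vs 0 0 (lexx _))) => i.
  by apply: uclZ; exact: Vs.
move=> x; pose S i := s (a i) x.
have SS i : S i.+1 <= S i by exact: smono.
have sumS : \sum_(i < n) (S i - S i.+1) = S 0%N - S n.
  rewrite -(big_mkord xpredT (fun i => S i - S i.+1)).
  under eq_bigr do rewrite -opprB.
  by rewrite sumrN telescope_sumr// opprB.
(* Slope 1 below t and above 1 - t, constant in between. On a far cell the increments of phi and of
   the identity agree, so the weight of all far cells telescopes to at most phi 1 - phi 0 = 2 t. *)
pose phi (v : R) := Num.min v t + Num.max v (1 - t).
have phi_mono u v : u <= v -> phi u <= phi v.
  move=> uv; rewrite /phi; clearbody t; apply: lerD.
    by rewrite le_min !ge_min uv lexx orbT.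
  by rewrite ge_max !le_max uv lexx orbT.
have -> : f x - \sum_(i < n) f (a i) * (s (a i) x - s (a i.+1) x) =
    f x * (1 - (S 0%N - S n)) + \sum_(i < n) (f x - f (a i)) * (S i - S i.+1).
  rewrite mulrBr mulr1 -sumS mulr_sumr -addrA; congr (_ + _).
  rewrite -sumrN -sumrN -big_split/=; apply: eq_bigr => i _.
  by rewrite mulrBl -/(S i) -/(S i.+1); ring.
have S01 i : 0 <= S i <= 1 by exact: s01.
apply: le_trans (ler_normD _ _) _.
have first : `|f x * (1 - (S 0%N - S n))| <= B * (2 * t).
  have [xM|/f0 ->] := leP `|x| M'; last first.
    by rewrite mul0r normr0 mulr_ge0//; move: B1 t0; lra.
  rewrite normrM; apply: ler_pM => //.
  have an : a n = L by rewrite /a /h [_ * (_ / _)]mulrC divfK ?gt_eqF//; ring.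
  have a0 : a 0%N = - L by rewrite /a mul0r addr0.
  move: xM; rewrite ler_norml => /andP[x1 x2].
  have h1 : 1 - t <= S 0%N by apply: shi; rewrite a0 /L; move: x1 d1; lra.
  have h2 : S n <= t by apply: slo; rewrite an /L; move: x2 d1; lra.
  have /andP[? ?] := S01 0%N; have /andP[? ?] := S01 n.
  rewrite ler_norml; apply/andP; split; lra.
have second : `|\sum_(i < n) (f x - f (a i)) * (S i - S i.+1)| <=
    e + 2 * B * (2 * t).
  apply: le_trans (ler_norm_sum _ _ _) _.
  apply: (@le_trans _ _ (\sum_(i < n) (e * (S i - S i.+1) +
      2 * B * (phi (S i) - phi (S i.+1))))).
    apply: ler_sum => i _; rewrite normrM.
    have Si : 0 <= S i - S i.+1 by rewrite subr_ge0.
    rewrite (ger0_norm Si).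
    have phii : 0 <= phi (S i) - phi (S i.+1) by rewrite subr_ge0 phi_mono.
    have far : phi (S i) - phi (S i.+1) = S i - S i.+1 ->
       `|f x - f (a i)| * (S i - S i.+1) <=
       e * (S i - S i.+1) + 2 * B * (phi (S i) - phi (S i.+1)).
      move=> ->; rewrite -mulrDl ler_wpM2r//.
      apply: (le_trans (ler_normB _ _)).
      by have := hB x; have := hB (a i); move: e_gt0; lra.
    have [xa|ax] := ltP `|x - a i| r.
      apply: (@le_trans _ _ (e * (S i - S i.+1))).
        by rewrite ler_wpM2r//; exact: hr.
      rewrite lerDl mulr_ge0//; move: B1; lra.
    apply: far; move: ax; rewrite ler_normr => /orP[ax|ax].
      have h1 : 1 - t <= S i by apply: shi; move: dr r0 ax; lra.
      have h2 : 1 - t <= S i.+1 by apply: shi; rewrite aS; move: dr hr2 ax; lra.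
      rewrite /phi (max_l h1) (max_l h2) !min_r; [by ring|move: t2 h2; lra|
        move: t2 h1; lra].
    have h1 : S i <= t by apply: slo; move: dr r0 ax; lra.
    have h2 : S i.+1 <= t by apply: slo; rewrite aS; move: dr r0 h0 ax; lra.
    rewrite /phi (min_l h1) (min_l h2) !max_r; [by ring|move: t2 h2; lra|
      move: t2 h1; lra].
  rewrite big_split/= -!mulr_sumr sumS.
  rewrite -(big_mkord xpredT (fun i => phi (S i) - phi (S i.+1))).
  under eq_bigr do rewrite -opprB.
  rewrite sumrN telescope_sumr// opprB.
  have /andP[? ?] := S01 0%N; have /andP[? ?] := S01 n.
  apply: lerD.
    rewrite ler_piMr ?(ltW e_gt0)//; lra.
  rewrite ler_wpM2l//; first by move: B1; lra.
  have p0 : phi 0 = 1 - t.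
    rewrite /phi min_l ?(ltW t0)// max_r ?add0r//; move: t2; lra.
  have p1 : phi 1 = t + 1.
    rewrite /phi min_r ?max_l//; move: t2 t0; lra.
  have : phi 0 <= phi (S n) by exact: phi_mono.
  have : phi (S 0%N) <= phi 1 by exact: phi_mono.
  rewrite p0 p1; lra.
apply: (le_trans (lerD first second)); move: tB; rewrite /e; nra.
Qed.

Lemma ucl_resolvents_compact_support (b : R) f (M : R) : 0 < b ->
  (forall y, b < y -> VC (resolvent (0 +i* y))) ->
  Cb f -> (forall x, M < `|x| -> f x = 0) -> V f.
Proof.
move=> b0 hb; apply: ucl_compact_support => d e d0 e0.
have pi0 := @pi_gt0 R.
have [K K0 hK] : exists2 K : R, 0 < K & pi / 2 - e * pi <= atan K.
  have ep : 0 < e * pi by rewrite mulr_gt0.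
  have /cvgrPdist_le/(_ _ ep) := @cvgy_atan R.
  move=> [K0 [_ hK0]].
  exists (Num.max K0 0 + 1); first by rewrite ltr_wpDl// le_max lexx orbT.
  have /hK0 : K0 < Num.max K0 0 + 1.
    by rewrite (@le_lt_trans _ _ (Num.max K0 0))// ?ltrDl// le_max lexx.
  by rewrite ler_norml => /andP[_]; lra.
(* At distance d from the step the argument of the arctangent reaches K, beyond which it is within e
   pi of its limit. *)
pose y := d / K; have y0 : 0 < y by rewrite divr_gt0.
exists (fun a x => 2^-1 + atan ((x - a) / y) / pi).
  have A (x : R) : - (pi / 2) <= atan x <= pi / 2.
    by rewrite !ltW ?atan_gtNpi2 ?atan_ltpi2.
  have yK : d / y = K by rewrite /y; field; rewrite !gt_eqF.
  split.
  - move=> a x; have /andP[h1 h2] := A ((x - a) / y).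
    have : - 2^-1 <= atan ((x - a) / y) / pi.
      by rewrite ler_pdivlMr//; move: h1; lra.
    have : atan ((x - a) / y) / pi <= 2^-1.
      by rewrite ler_pdivrMr//; move: h2; lra.
    by move=> ? ?; apply/andP; split; lra.
  - move=> a a' x aa; rewrite lerD2l ler_wpM2r ?invr_ge0 ?(ltW pi0)//.
    by rewrite le_atan// ler_wpM2r ?invr_ge0 ?(ltW y0)// lerD2l lerN2.
  - move=> a x ax.
    have h : atan K <= atan ((x - a) / y).
      rewrite le_atan// -yK ler_wpM2r ?invr_ge0 ?(ltW y0)//.
      by move: ax; lra.
    have : 2^-1 - e <= atan ((x - a) / y) / pi.
      by rewrite ler_pdivlMr//; move: h hK; lra.
    lra.
  - move=> a x ax.
    have h : atan ((x - a) / y) <= - atan K.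
      rewrite -atanN le_atan// -yK -mulNr ler_wpM2r ?invr_ge0 ?(ltW y0)//.
      by move: ax; lra.
    have : atan ((x - a) / y) / pi <= - 2^-1 + e.
      by rewrite ler_pdivrMr//; move: h hK; lra.
    lra.
move=> u v uv.
rewrite (_ : (fun x => _) = fun x =>
   pi^-1 * (atan ((v - x) / y) - atan ((u - x) / y))).
  by apply: uclZ; apply: ucl_atan => // w; exact: (@ucl_poisson b).
apply/funext => x; rewrite -(opprB v x) -(opprB u x) !mulNr !atanN.
by ring.
Qed.

End UniformlyClosed.

End Density.

(** * Weak limits and their representation *)

Section WeakLimits.
Context {R : realType}.
Local Open Scope complex_scope.
Implicit Types (f g : R -> R) (E : (R -> R) -> R).

Definition clamp (x : R) : R := Num.max 0 (Num.min 1 x).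

Lemma clamp01 x : 0 <= clamp x <= 1.
Proof. by rewrite le_max lexx ge_max ler01 ge_min lexx. Qed.

Lemma clamp_le0 x : x <= 0 -> clamp x = 0.
Proof. by move=> x0; rewrite /clamp min_r ?max_l// (le_trans x0). Qed.

Lemma clamp_ge1 x : 1 <= x -> clamp x = 1.
Proof. by move=> x1; rewrite /clamp min_l ?max_r. Qed.

Lemma clampE x : 0 <= x <= 1 -> clamp x = x.
Proof. by case/andP => x0 x1; rewrite /clamp min_r// max_r. Qed.

Lemma le_clamp x y : x <= y -> clamp x <= clamp y.
Proof.
move=> xy; rewrite /clamp ge_max !le_max lexx/=; apply/orP; right.
by rewrite le_min !ge_min lexx xy orbT.
Qed.

Lemma clampD x d : 0 <= d -> clamp (x + d) <= clamp x + d.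
Proof.
move=> d0; have /andP[h1 h2] := clamp01 x; have /andP[h3 h4] := clamp01 (x + d).
have [x0|x0] := leP x 0.
  rewrite (clamp_le0 x0) add0r.
  have [xd|xd] := leP (x + d) 0; first by rewrite (clamp_le0 xd).
  have [xd1|xd1] := leP (x + d) 1; first by rewrite clampE ?(ltW xd)//; lra.
  by rewrite clamp_ge1 ?(ltW xd1)//; lra.
have [x1|x1] := leP 1 x; first by rewrite (clamp_ge1 x1) (le_trans h4)// lerDl.
rewrite (@clampE x) ?(ltW x0) ?(ltW x1)//.
have [xd1|xd1] := leP (x + d) 1; first by rewrite clampE//; lra.
by rewrite clamp_ge1 ?(ltW xd1)//; lra.
Qed.

Lemma Cb_clamp_comp f : continuous f -> Cb (fun x => clamp (f x)).
Proof.
move=> cf; split; last first.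
  by exists 1 => x; have /andP[h0 h1] := clamp01 (f x); rewrite ger0_norm.
move=> x; apply: (@continuous_max _ _ (fun=> 0) (fun x => Num.min 1 (f x))).
  exact: cvg_cst.
apply: (@continuous_min _ _ (fun=> 1) f); [exact: cvg_cst|exact: cf].
Qed.

Definition cutoff (M x : R) : R := clamp (M + 1 - `|x|).

Lemma Cb_cutoff M : Cb (cutoff M).
Proof.
apply: Cb_clamp_comp => x; apply: cvgB; first exact: cvg_cst.
exact: norm_continuous.
Qed.

Lemma cutoff_supp M x : M + 1 < `|x| -> cutoff M x = 0.
Proof. by move=> h; rewrite /cutoff clamp_le0// subr_le0 ltW. Qed.

Lemma cutoff_tail M x : 0 < M -> 0 <= 1 - cutoff M x <= 2 * tail M x.
Proof.
move=> M0; have /andP[h1 h2] := clamp01 (M + 1 - `|x|).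
rewrite subr_ge0 h2/=.
have [xM|Mx] := leP `|x| M.
  rewrite /cutoff clamp_ge1; last by move: xM; lra.
  by rewrite subrr; apply: mulr_ge0 => //; exact: tail_ge0.
have := tail_ge_half M0 (ltW Mx); rewrite /cutoff; lra.
Qed.

Lemma mean_cutoff E f (M B : R) : mean E -> 0 < M -> Cb f ->
  (forall x, `|f x| <= B) ->
  `|E f - E (fun x => f x * cutoff M x)| <= B * (2 * E (tail M)).
Proof.
move=> hE M0 cf fB; have cfc := CbM cf (Cb_cutoff M).
have B0 : 0 <= B by exact: le_trans (fB 0).
rewrite -(meanB hE)// -(meanZ hE); last exact: Cb_tail.
rewrite -(meanZ hE); last by apply: CbZ; exact: Cb_tail.
apply: (mean_norm_le hE) => [||x].
- exact: CbB.
- by do 2 apply: CbZ; exact: Cb_tail.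
rewrite -[X in X - _]mulr1 -mulrBr normrM ler_pM//.
by have /andP[h1 h2] := cutoff_tail x M0; rewrite ger0_norm.
Qed.

Lemma cvgn_approx (v : R^nat) :
  (forall e : R, 0 < e ->
     exists2 u : R^nat, cvgn u & \forall j \near \oo, `|v j - u j| <= e) ->
  cvgn v.
Proof.
move=> h; apply/cauchy_cvgP; apply: cauchy_exP => e e0.
have e2 : 0 < e / 3 by rewrite divr_gt0.
have [u cu vu] := h _ e2; exists (lim (u @ \oo)).
have /cvgrPdist_le/(_ _ e2) := cu => lu.
suff : \forall j \near \oo, ball (lim (u @ \oo)) e (v j) by [].
near=> j; rewrite -ball_normE /=.
have -> : lim (u @ \oo) - v j = (lim (u @ \oo) - u j) - (v j - u j) by ring.
apply: le_lt_trans (ler_normB _ _) _.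
apply: (@le_lt_trans _ _ (e / 3 + e / 3)); last by lra.
by apply: lerD; near: j.
Unshelve. all: by end_near. Qed.

Lemma uniformly_closed_cvg (E : nat -> (R -> R) -> R) :
  (forall j, mean (E j)) -> uniformly_closed [set f | Cb f /\ cvgn (E ^~ f)].
Proof.
move=> hE; split=> [a f g [cf Ef] [cg Eg]|f cf h].
  split; first by apply: CbD => //; exact: CbZ.
  rewrite (_ : E ^~ _ = fun j => a * E j f + E j g).
    by apply: is_cvgD => //; exact: is_cvgMr.
  by apply/funext => j; rewrite (mean_linear (hE j)).
split=> //; apply: cvgn_approx => e /h[g [cg Eg] fg].
exists (E ^~ g) => //; apply: nearW => j.
by rewrite -(meanB (hE j))// (mean_bound (hE j))//; exact: CbB.
Qed.

Lemma uniformly_closed_eq E E' : mean E -> mean E' ->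
  uniformly_closed [set f | Cb f /\ E f = E' f].
Proof.
move=> hE hE'; split=> [a f g [cf Ef] [cg Eg]|f cf h].
  split; first by apply: CbD => //; exact: CbZ.
  by rewrite (mean_linear hE)// (mean_linear hE')// Ef Eg.
split=> //; apply/eqP; rewrite -subr_eq0 -normr_eq0 eq_le normr_ge0 andbT.
apply/ler_addgt0Pr => e e0; rewrite add0r.
have [g [cg Eg] fg] := h _ (divr_gt0 e0 (ltr0Sn R 1)).
have -> : E f - E' f = (E f - E g) - (E' f - E' g) by rewrite Eg; ring.
apply: le_trans (ler_normB _ _) _; rewrite (splitr e).
by apply: lerD; rewrite -meanB// mean_bound//; exact: CbB.
Qed.

Lemma mean_eq_compact_support E E' : mean E -> mean E' -> tight E -> tight E' ->
  (forall f M, Cb f -> (forall x, M < `|x| -> f x = 0) -> E f = E' f) ->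
  forall f, Cb f -> E f = E' f.
Proof.
move=> hE hE' tE tE' h f cf; have [_ [B0 hB0]] := cf.
pose B := Num.max B0 1.
have hB x : `|f x| <= B by rewrite le_max hB0.
have B1 : 1 <= B by rewrite le_max lexx orbT.
have B_gt0 : 0 < B by exact: lt_le_trans B1.
apply/eqP; rewrite -subr_eq0 -normr_eq0 eq_le normr_ge0 andbT.
apply/ler_addgt0Pr => e e0; rewrite add0r.
have e4 : 0 < e / (4 * B) by rewrite divr_gt0// mulr_gt0.
have [y y0 Ey] := tE _ e4; have [y' y'0 Ey'] := tE' _ e4.
(* [tail] decreases in its parameter, so the larger radius serves both means. *)
pose M := Num.max y y'.
have M0 : 0 < M by rewrite lt_max y0.
have tail_le u : 0 < u -> u <= M -> forall x, tail M x <= tail u x.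
  move=> u0 uM x; rewrite /tail.
  rewrite ler_wpM2l ?sqr_ge0// lef_pV2 ?posrE ?ltr_wpDl ?sqr_ge0 ?exprn_gt0//.
  by rewrite lerD2l ler_sqr ?nnegrE ?(ltW u0) ?(ltW M0).
have {}Ey : E (tail M) <= e / (4 * B).
  apply: le_trans Ey; apply: (le_mean hE); try exact: Cb_tail.
  by apply: tail_le => //; rewrite le_max lexx.
have {}Ey' : E' (tail M) <= e / (4 * B).
  apply: le_trans Ey'; apply: (le_mean hE'); try exact: Cb_tail.
  by apply: tail_le => //; rewrite le_max lexx orbT.
have c1 := mean_cutoff hE M0 cf hB; have c2 := mean_cutoff hE' M0 cf hB.
have eqc : E (fun x => f x * cutoff M x) = E' (fun x => f x * cutoff M x).
  apply: (h _ (M + 1)); first exact: CbM cf (Cb_cutoff M).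
  by move=> x /cutoff_supp ->; rewrite mulr0.
rewrite eqc in c1; set c := E' _ in c1 c2.
have -> : E f - E' f = (E f - c) - (E' f - c) by ring.
apply: le_trans (ler_normB _ _) _; apply: le_trans (lerD c1 c2) _.
have : B * (2 * E (tail M)) <= B * (2 * (e / (4 * B))).
  by rewrite ler_wpM2l ?(ltW B_gt0)// ler_wpM2l.
have : B * (2 * E' (tail M)) <= B * (2 * (e / (4 * B))).
  by rewrite ler_wpM2l ?(ltW B_gt0)// ler_wpM2l.
have -> : B * (2 * (e / (4 * B))) = e / 2 by field; rewrite gt_eqF.
lra.
Qed.

Lemma mean_eq_cauchy E E' (b : R) : mean E -> mean E' -> tight E -> tight E' ->
  0 < b -> (forall y, b < y -> cauchy E (0 +i* y) = cauchy E' (0 +i* y)) ->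
  forall f, Cb f -> E f = E' f.
Proof.
move=> hE hE' tE tE' b0 h; apply: mean_eq_compact_support => // f M cf f0.
have [_] : [set f | Cb f /\ E f = E' f] f; last by [].
apply: (@ucl_resolvents_compact_support _ _ (uniformly_closed_eq hE hE') b f M)
  => // y yb.
have [c1 c2] := @CbC_resolvent R (0 +i* y) (lt_trans b0 yb).
by have [e1 e2] := h _ yb; split; split.
Qed.

Definition asymptotically_tight (E : nat -> (R -> R) -> R) := forall e : R,
  0 < e -> exists2 y, 0 < y & \forall j \near \oo, E j (tail y) <= e.

(** No subsequence is extracted: convergence passes from resolvents to compactly supported functions
    by uniform closure, and tightness controls the part removed by the cutoff. *)
Lemma means_cvg (E : nat -> (R -> R) -> R) (b : R) : (forall j, mean (E j)) ->
  asymptotically_tight E -> 0 < b ->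
  (forall y, b < y ->
    cvgn (fun j => complex.Re (cauchy (E j) (0 +i* y))) /\
    cvgn (fun j => complex.Im (cauchy (E j) (0 +i* y)))) ->
  forall f, Cb f -> cvgn (E ^~ f).
Proof.
move=> hE tE b0 h f cf; have [_ [B0 hB0]] := cf.
pose B := Num.max B0 1.
have hB x : `|f x| <= B by rewrite le_max hB0.
have B1 : 1 <= B by rewrite le_max lexx orbT.
have B_gt0 : 0 < B by exact: lt_le_trans B1.
apply: cvgn_approx => e e0.
have e4 : 0 < e / (2 * B) by rewrite divr_gt0// mulr_gt0.
have [y y0 Ey] := tE _ e4.
exists (fun j => E j (fun x => f x * cutoff y x)).
  suff [] : [set f | Cb f /\ cvgn (E ^~ f)] (fun x => f x * cutoff y x) by [].
  apply: (@ucl_resolvents_compact_support _ _ (uniformly_closed_cvg hE) b _ (y + 1))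
    => // [u ub||x /cutoff_supp ->]; last 2 first.
  - exact: CbM cf (Cb_cutoff y).
  - by rewrite mulr0.
  have [c1 c2] := @CbC_resolvent R (0 +i* u) (lt_trans b0 ub).
  by have [h1 h2] := h _ ub; split; split.
near=> j; apply: le_trans (mean_cutoff (hE j) y0 cf hB) _.
have Ej : E j (tail y) <= e / (2 * B) by near: j.
have -> : e = B * (2 * (e / (2 * B))) by field; rewrite gt_eqF.
by rewrite ler_wpM2l ?(ltW B_gt0)// ler_wpM2l.
Unshelve. all: by end_near. Qed.

Lemma tight_lim (E : nat -> (R -> R) -> R) : (forall j, mean (E j)) ->
  asymptotically_tight E -> (forall f, Cb f -> cvgn (E ^~ f)) ->
  tight (fun f => limn (E ^~ f)).
Proof.
move=> hE tE cE e /tE[y y0 Ey]; exists y => //.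
by apply: limr_le => //; apply: cE; exact: Cb_tail.
Qed.

End WeakLimits.

(** * Representation of a tight mean by a probability measure *)

Section Representation.
Context {R : realType}.
Implicit Types (f g : R -> R) (E : (R -> R) -> R).

Definition ramp (a h x : R) : R := clamp ((a + h - x) / h).

Lemma ramp01 a h x : 0 <= ramp a h x <= 1. Proof. exact: clamp01. Qed.

Lemma ramp_eq1 a h x : 0 < h -> x <= a -> ramp a h x = 1.
Proof. by move=> h0 xa; rewrite /ramp clamp_ge1// ler_pdivlMr//; lra. Qed.

Lemma ramp_eq0 a h x : 0 < h -> a + h <= x -> ramp a h x = 0.
Proof.
by move=> h0 xa; rewrite /ramp clamp_le0// ler_pdivrMr// mul0r; lra.
Qed.

Lemma Cb_ramp a h : Cb (ramp a h).
Proof.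
apply: Cb_clamp_comp => x; apply: cvgM; last exact: cvg_cst.
by apply: cvgB; [exact: cvg_cst|exact: cvg_id].
Qed.

Lemma ramp_mono a a' h x : 0 < h -> a <= a' -> ramp a h x <= ramp a' h x.
Proof.
move=> h0 aa; apply: le_clamp.
by rewrite ler_wpM2r ?invr_ge0 ?(ltW h0)//; lra.
Qed.

Lemma ramp_shift a h d x : 0 < h -> 0 <= d ->
  ramp (a + d) h x <= ramp a h x + d / h.
Proof.
move=> h0 d0; rewrite /ramp.
have -> : (a + d + h - x) / h = (a + h - x) / h + d / h.
  by rewrite -mulrDl; congr (_ / _); ring.
by apply: clampD; rewrite divr_ge0// ltW.
Qed.

Lemma clamp_sum (v : R) (n : nat) :
  \sum_(i < n) clamp (i.+1%:R - v) = Num.max 0 (Num.min n%:R (n%:R - v)).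
Proof.
elim: n => [|n IH].
  by rewrite big_ord0 max_l// ge_min lexx.
rewrite big_ord_recr/= IH /clamp -natr1.
have n0 : 0 <= n%:R :> R by exact: ler0n.
set N := n%:R in n0 *.
have [v0|v0] := leP v 0.
  by rewrite !min_l ?max_r//; lra.
have [vN|vN] := leP v N.
  rewrite (@min_r _ _ N) ?(@max_r _ _ 0 (N - v)); [|lra|lra].
  rewrite (@min_l _ _ 1) ?(@max_r _ _ 0 1); [|lra|lra].
  rewrite min_r ?max_r; lra.
have [vN1|vN1] := leP v (N + 1).
  rewrite (@min_r _ _ N) ?(@max_l _ _ 0 (N - v)); [|lra|lra].
  rewrite (@min_r _ _ 1) ?(@max_r _ _ 0 (N + 1 - v)); [|lra|lra].
  rewrite min_r ?max_r; lra.
rewrite (@min_r _ _ N) ?(@max_l _ _ 0 (N - v)); [|lra|lra].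
rewrite (@min_r _ _ 1) ?(@max_l _ _ 0 (N + 1 - v)); [|lra|lra].
rewrite min_r ?max_l; lra.
Qed.

(** Cells to the right of x contribute 1, those to the left 0, and the cell of x the missing
    fraction. *)
Lemma ramp_subdivision (a h x : R) (n : nat) : 0 < h ->
  \sum_(i < n.+1) ramp (a + i%:R * (h / n.+1%:R)) (h / n.+1%:R) x =
  n.+1%:R * ramp a h x.
Proof.
move=> h0; have n0 : 0 < n.+1%:R :> R by rewrite ltr0n.
set N := n.+1%:R in n0 *; pose v := (x - a) * N / h.
transitivity (\sum_(i < n.+1) clamp (i.+1%:R - v)).
  apply: eq_bigr => i _; rewrite /ramp; congr clamp.
  by rewrite /v -natr1; field; rewrite !gt_eqF.
rewrite clamp_sum -/N /ramp /clamp.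
have -> : (a + h - x) / h = (N - v) / N.
  by rewrite /v; field; rewrite !gt_eqF.
rewrite maxr_pMr ?(ltW n0)// mulr0; congr Num.max.
rewrite minr_pMr ?(ltW n0)// mulr1; congr Num.min.
by rewrite mulrC divfK// gt_eqF.
Qed.

Lemma mean_sum E (n : nat) (f : 'I_n -> R -> R) : mean E -> (forall i, Cb (f i)) ->
  Cb (fun x => \sum_(i < n) f i x) /\
  E (fun x => \sum_(i < n) f i x) = \sum_(i < n) E (f i).
Proof.
move=> hE; elim: n f => [|n IH] f cf.
  rewrite big_ord0; split.
    by under [X in Cb X]funext do rewrite big_ord0; exact: Cb_cst.
  by under [X in E X]funext do rewrite big_ord0; exact: mean0.
have [c e] := IH _ (fun i => cf (widen_ord (leqnSn n) i)).
rewrite big_ord_recr/= -e -(meanD hE)//; split.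
  by under [X in Cb X]funext do rewrite big_ord_recr/=; exact: CbD.
by congr E; apply/funext => x; rewrite big_ord_recr.
Qed.

(* F squeezes the values of both functionals on ramps; subdividing a ramp into
   n steeper ones makes the two bounds differ by at most 1/n. *)
Lemma mean_ramp_unique E E' (F : R -> R) : mean E -> mean E' ->
  (forall x, 0 <= F x <= 1) ->
  (forall a h, 0 < h -> F a <= E (ramp a h) <= F (a + h)) ->
  (forall a h, 0 < h -> F a <= E' (ramp a h) <= F (a + h)) ->
  forall a h, 0 < h -> E (ramp a h) = E' (ramp a h).
Proof.
move=> hE hE' F01 FE FE' a h h0.
apply/eqP; rewrite -subr_eq0 -normr_eq0 eq_le normr_ge0 andbT.
apply/ler_addgt0Pr => e e0; rewrite add0r.
pose n := Num.truncn e^-1; have hn : e^-1 < n.+1%:R by exact: truncnS_gt.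
have n0 : 0 < n.+1%:R :> R by rewrite ltr0n.
pose k := h / n.+1%:R; have k0 : 0 < k by rewrite divr_gt0.
have Ek G : mean G -> n.+1%:R * G (ramp a h) =
    \sum_(i < n.+1) G (ramp (a + i%:R * k) k).
  move=> hG.
  have [_ <-] := @mean_sum G n.+1 (fun i => ramp (a + i%:R * k) k) hG
     (fun i => Cb_ramp _ _).
  rewrite -(meanZ hG); last exact: Cb_ramp.
  by congr G; apply/funext => x; rewrite ramp_subdivision.
suff : n.+1%:R * `|E (ramp a h) - E' (ramp a h)| <= 1.
  rewrite mulrC -ler_pdivlMr// => /le_trans; apply.
  by rewrite mul1r -[leRHS]invrK lef_pV2 ?posrE ?invr_gt0// ltW.
have -> : n.+1%:R * `|E (ramp a h) - E' (ramp a h)| =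
    `|n.+1%:R * (E (ramp a h) - E' (ramp a h))| by rewrite normrM (gtr0_norm n0).
rewrite mulrBr !Ek// -sumrB.
apply: le_trans (ler_norm_sum _ _ _) _.
apply: (@le_trans _ _ (\sum_(i < n.+1)
    (F (a + i.+1%:R * k) - F (a + i%:R * k)))).
  apply: ler_sum => i _.
  have -> : a + i.+1%:R * k = a + i%:R * k + k.
    by rewrite -natr1 mulrDl mul1r addrA.
  have /andP[h1 h2] := FE (a + i%:R * k) _ k0.
  have /andP[h3 h4] := FE' (a + i%:R * k) _ k0.
  by rewrite ler_norml; apply/andP; split; lra.
rewrite -(big_mkord xpredT (fun i => F (a + i.+1%:R * k) - F (a + i%:R * k))).
rewrite (telescope_sumr (fun i => F (a + i%:R * k)))//.
have /andP[h1 h2] := F01 (a + n.+1%:R * k).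
have /andP[h3 h4] := F01 (a + 0%:R * k).
lra.
Qed.

Section DistributionFunction.
Variables (E : (R -> R) -> R) (hE : mean E) (tE : tight E).

(** Ramps decrease to the indicator of ]-oo, x] as h -> 0, so for an integral this is the cumulative
    distribution function. *)
Definition mean_cdf (x : R) : R := inf [set E (ramp x h) | h in [set h | 0 < h]].
Local Notation F := mean_cdf.

Lemma mean_ramp01 a h : 0 <= E (ramp a h) <= 1.
Proof.
apply/andP; split.
  apply: (mean_ge0 hE); first exact: Cb_ramp.
  by move=> x; have /andP[] := ramp01 a h x.
rewrite -(mean_cst hE 1) (le_mean hE)//; [exact: Cb_ramp|exact: Cb_cst|].
by move=> x; have /andP[] := ramp01 a h x.
Qed.

Lemma mean_cdf_le a h : 0 < h -> F a <= E (ramp a h).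
Proof.
move=> h0; apply: ge_inf; last by exists h.
by exists 0 => _ [k _ <-]; have /andP[] := mean_ramp01 a k.
Qed.

Lemma mean_cdf_ge a c : (forall h, 0 < h -> c <= E (ramp a h)) -> c <= F a.
Proof.
move=> h; apply: lb_le_inf; first by exists (E (ramp a 1)), 1 => //=.
by move=> _ [k /= k0 <-]; exact: h.
Qed.

Lemma mean_cdf01 x : 0 <= F x <= 1.
Proof.
apply/andP; split.
  by apply: mean_cdf_ge => h _; have /andP[] := mean_ramp01 x h.
apply: le_trans (mean_cdf_le x ltr01) _.
by have /andP[] := mean_ramp01 x 1.
Qed.

Lemma mean_cdf_nd : nondecreasing F.
Proof.
move=> x y xy; apply: mean_cdf_ge => h h0.
apply: le_trans (mean_cdf_le x h0) _.
apply: (le_mean hE); try exact: Cb_ramp.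
by move=> u; exact: ramp_mono.
Qed.

Lemma mean_cdf_rc : right_continuous F.
Proof.
move=> a; apply/cvgrPdist_le => e e0.
have e2 : 0 < e / 2 by rewrite divr_gt0.
(* A nearly optimal h at a is frozen; moving its ramp to x costs only (x - a) / h. *)
have [h h0 hF] : exists2 h, 0 < h & E (ramp a h) < F a + e / 2.
  have := @inf_adherent _ [set E (ramp a h) | h in [set h | 0 < h]] _ e2.
  have hi : has_inf [set E (ramp a h) | h in [set h | 0 < h]].
    split; first by exists (E (ramp a 1)), 1 => //=.
    by exists 0 => _ [k _ <-]; have /andP[] := mean_ramp01 a k.
  by move=> /(_ hi)[_ [h h0 <-] hh]; exists h.
have d0 : 0 < h * (e / 2) by rewrite mulr_gt0.
near=> x.
have ax : a < x by near: x; exact: nbhs_right_gt.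
have xa : x < a + h * (e / 2).
  by near: x; apply: nbhs_right_lt; rewrite ltrDl.
have h1 : F a <= F x by apply: mean_cdf_nd; exact: ltW.
have h2 : F x <= E (ramp a h) + (x - a) / h.
  apply: le_trans (mean_cdf_le x h0) _.
  rewrite -[X in _ + X](mean_cst hE) -(meanD hE); [|exact: Cb_ramp|exact: Cb_cst].
  apply: (le_mean hE); first exact: Cb_ramp.
    by apply: CbD; [exact: Cb_ramp|exact: Cb_cst].
  move=> u; have := @ramp_shift a h (x - a) u h0.
  rewrite (_ : a + (x - a) = x); last by ring.
  by apply; rewrite subr_ge0 ltW.
have h3 : (x - a) / h <= e / 2 by rewrite ler_pdivrMr// mulrC; move: xa; lra.
by rewrite ler0_norm; lra.
Unshelve. all: by end_near. Qed.

Lemma mean_cdf_cvgy : F @ +oo --> (1 : R).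
Proof.
apply/cvgrPdist_le => e e0.
have [y y0 Ey] := tE (divr_gt0 e0 (ltr0Sn R 1)).
near=> x; have yx : y <= x by near: x; exact: nbhs_pinfty_ge (num_real _).
have /andP[h1 h2] := mean_cdf01 x.
rewrite ger0_norm ?subr_ge0// lerBlDr -lerBlDl.
apply: mean_cdf_ge => h h0.
apply: (@le_trans _ _ (E (fun u => 1 - 2 * tail y u))).
  rewrite (meanB hE); [|exact: Cb_cst|apply: CbZ; exact: Cb_tail].
  rewrite (mean_cst hE) (meanZ hE); last exact: Cb_tail.
  by move: Ey; lra.
apply: (le_mean hE); [|exact: Cb_ramp|move=> u].
  by apply: CbB; [exact: Cb_cst|apply: CbZ; exact: Cb_tail].
have [ux|xu] := leP u x.
  by rewrite ramp_eq1//; have := tail_ge0 y u; lra.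
have /andP[h3 _] := ramp01 x h u.
have : y <= `|u| by apply: le_trans yx (le_trans (ltW xu) (ler_norm _)).
by move=> /(tail_ge_half y0); lra.
Unshelve. all: by end_near. Qed.

Lemma mean_cdf_cvgNy : F @ -oo --> (0 : R).
Proof.
apply/cvgrPdist_le => e e0.
have [y y0 Ey] := tE (divr_gt0 e0 (ltr0Sn R 1)).
near=> x; have yx : x <= - y - 1 by near: x; exact: nbhs_ninfty_le (num_real _).
have /andP[h1 h2] := mean_cdf01 x.
rewrite sub0r normrN ger0_norm//.
apply: le_trans (mean_cdf_le x ltr01) _.
apply: (@le_trans _ _ (E (fun u => 2 * tail y u))); last first.
  rewrite (meanZ hE); last exact: Cb_tail.
  by move: Ey; lra.
apply: (le_mean hE); [exact: Cb_ramp|apply: CbZ; exact: Cb_tail|move=> u].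
have /andP[h3 h4] := ramp01 x 1 u.
have [xu|ux] := leP (x + 1) u.
  by rewrite ramp_eq0//; have := tail_ge0 y u; lra.
have : y <= `|u| by rewrite ler_normr; apply/orP; right; lra.
by move=> /(tail_ge_half y0); lra.
Unshelve. all: by end_near. Qed.

HB.instance Definition _ :=
  isCumulative.Build R _ R mean_cdf mean_cdf_nd mean_cdf_rc.

HB.instance Definition _ :=
  isCumulativeBounded.Build R 0 1 mean_cdf mean_cdf_cvgNy mean_cdf_cvgy.

Definition mean_measure : probability (measurableTypeR R) R :=
  lebesgue_stieltjes_measure mean_cdf.

Lemma mean_measure_cdf (r : R) : mean_measure `]-oo, r]%classic = (F r)%:E.
Proof. by have := @cdf_lebesgue_stieltjes_id R mean_cdf r; rewrite /cdf. Qed.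

Lemma mean_measure_ramp a h : 0 < h ->
  F a <= \int[mean_measure]_x ramp a h x <= F (a + h).
Proof.
move=> h0.
have mI r : measurable (`]-oo, r]%classic : set (measurableTypeR R)).
  exact: measurable_itv.
have I r : \int[mean_measure]_x (\1_(`]-oo, r]%classic) x : R) = F r.
  rewrite /Rintegral integral_indic// setIT.
  exact: (congr1 fine (mean_measure_cdf r)).
have iI r : mean_measure.-integrable setT
    (EFin \o (\1_(`]-oo, r]%classic : set R) : R -> R)).
  exact: integrable_indic.
have iR : mean_measure.-integrable setT (EFin \o ramp a h).
  by apply: integrable_Cb; exact: Cb_ramp.
apply/andP; split; rewrite -I; apply: le_Rintegral => // x _.
  have /andP[r0 _] := ramp01 a h x.
  rewrite indicE; case: (boolP (x \in _)) => //.
  by rewrite inE/= in_itv/= => xa; rewrite ramp_eq1.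
have /andP[_ r1] := ramp01 a h x.
rewrite indicE; case: (boolP (x \in _)) => //.
by rewrite notin_setE/= in_itv/= => /negP; rewrite -ltNge => /ltW ?; rewrite ramp_eq0.
Qed.

(** Both functionals are squeezed by [mean_cdf] on ramps, hence agree there. Complements of ramps
    are sigmoids with no error outside the window, which gives compact supports, and tightness gives
    the rest. *)
Lemma mean_representation f : Cb f -> E f = \int[mean_measure]_x f x.
Proof.
have hE' := mean_Rintegral mean_measure.
move: f; apply: mean_eq_compact_support => //; first exact: tight_Rintegral.
move=> f M cf f0.
have eqr a h : 0 < h -> E (ramp a h) = \int[mean_measure]_x ramp a h x.
  apply: (mean_ramp_unique hE hE' mean_cdf01); last exact: mean_measure_ramp.
  move=> b k k0; rewrite mean_cdf_le//=; apply: mean_cdf_ge => l l0.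
  apply: (le_mean hE); try exact: Cb_ramp.
  move=> u; have [ub|bu] := leP u (b + k).
    by rewrite (ramp_eq1 l0 ub); have /andP[] := ramp01 b k u.
  by rewrite (ramp_eq0 k0 (ltW bu)); have /andP[] := ramp01 (b + k) l u.
have [_] : [set f | Cb f /\ E f = \int[mean_measure]_x f x] f; last by [].
apply: (ucl_compact_support (uniformly_closed_eq hE hE')) f0 => // d e d0 e0.
exists (fun a x => 1 - ramp a d x).
  split.
  - by move=> a x; have /andP[? ?] := ramp01 a d x; apply/andP; split; lra.
  - by move=> a a' x aa; have := @ramp_mono a a' d x d0 aa; lra.
  - by move=> a x ax; rewrite ramp_eq0//; lra.
  - by move=> a x ax; rewrite ramp_eq1//; lra.
move=> a b _; rewrite (_ : (fun x => _) = (fun x => ramp b d x - ramp a d x)).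
  split; first by apply: CbB; exact: Cb_ramp.
  by rewrite (meanB hE) ?(meanB hE') ?eqr//; exact: Cb_ramp.
by apply/funext => x; ring.
Qed.

End DistributionFunction.

End Representation.

(** * Limits along characteristics *)

Section ComplexSequences.
Context {R : realType}.
Local Open Scope complex_scope.
Implicit Types (u v : nat -> R[i]) (l m : R[i]).
Local Notation N := Normc.normc.

(* Stated through the modulus in R, so that every limit below is a limit of
   real sequences. *)
Definition ccvg u l := N (u n - l) @[n --> \oo] --> (0 : R).

Lemma ccvg_le u l (b : R^nat) : (\forall n \near \oo, N (u n - l) <= b n) ->
  b n @[n --> \oo] --> 0 -> ccvg u l.
Proof.
move=> ub b0; apply: (@squeeze_cvgr _ _ _ _ (fun=> 0) b) => //.
  by near=> n; rewrite normc_ge0/=; near: n.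
exact: cvg_cst.
Unshelve. all: by end_near. Qed.

Lemma ccvg_near u l (e : R) : ccvg u l -> 0 < e ->
  \forall n \near \oo, N (u n - l) < e.
Proof.
move=> /cvgrPdist_lt h /h; apply: filterS => n /=.
by rewrite sub0r normrN ger0_norm ?normc_ge0.
Qed.

Lemma ccvg_Re_Im u l : complex.Re (u n) @[n --> \oo] --> complex.Re l ->
  complex.Im (u n) @[n --> \oo] --> complex.Im l -> ccvg u l.
Proof.
move=> hR hI; apply: (@ccvg_le _ _
   (fun n => `|complex.Re (u n) - complex.Re l| + `|complex.Im (u n) - complex.Im l|)).
  by apply: nearW => n; rewrite -ReB -ImB; exact: normc_le_Re_Im.
rewrite -[X in _ --> X](addr0 (0 : R)).
by apply: cvgD; apply/norm_cvg0P; apply/subr_cvg0.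
Qed.

Lemma ccvg_Re u l : ccvg u l -> complex.Re (u n) @[n --> \oo] --> complex.Re l.
Proof.
move=> h; apply/cvgrPdist_lt => e e0; move: (ccvg_near h e0).
apply: filterS => n; apply: le_lt_trans; rewrite distrC -ReB.
exact: normc_ge_normRe.
Qed.

Lemma ccvg_Im u l : ccvg u l -> complex.Im (u n) @[n --> \oo] --> complex.Im l.
Proof.
move=> h; apply/cvgrPdist_lt => e e0; move: (ccvg_near h e0).
apply: filterS => n; apply: le_lt_trans; rewrite distrC -ImB.
exact: normc_ge_normIm.
Qed.

Lemma ccvg_unique u l m : ccvg u l -> ccvg u m -> l = m.
Proof.
move=> ul um; apply: eqC.
  exact: cvg_unique (ccvg_Re ul) (ccvg_Re um).
exact: cvg_unique (ccvg_Im ul) (ccvg_Im um).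
Qed.

Lemma ccvg_cst l : ccvg (fun=> l) l.
Proof. by rewrite /ccvg subrr Normc.normc0; exact: cvg_cst. Qed.

Lemma ccvg_real (a : R^nat) (b : R) : a n @[n --> \oo] --> b ->
  ccvg (fun n => (a n)%:C) b%:C.
Proof. by move=> ab; apply: ccvg_Re_Im => //=; exact: cvg_cst. Qed.

Lemma ccvgB u v l m : ccvg u l -> ccvg v m -> ccvg (fun n => u n - v n) (l - m).
Proof.
move=> ul vm; apply: (ccvg_le (b := fun n => N (u n - l) + N (v n - m))).
  apply: nearW => n; rewrite (_ : _ - (l - m) = (u n - l) - (v n - m)).
    exact: normcB.
  by ring.
by rewrite -[X in _ --> X](addr0 (0 : R)); exact: cvgD.
Qed.

Lemma ccvgM u v l m : ccvg u l -> ccvg v m -> ccvg (fun n => u n * v n) (l * m).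
Proof.
move=> ul vm; apply: (ccvg_le (b := fun n => N (u n - l) * N (v n - m) +
    N l * N (v n - m) + N (u n - l) * N m)).
  apply: nearW => n; rewrite (_ : _ - l * m =
      (u n - l) * (v n - m) + l * (v n - m) + (u n - l) * m); last by ring.
  rewrite -!Normc.normcM; apply: le_trans (le_normcD _ _) _.
  by rewrite lerD2r; exact: le_normcD.
rewrite (_ : 0 = 0 * 0 + N l * 0 + 0 * N m); last by ring.
apply: cvgD; last by apply: cvgMl.
by apply: cvgD; [exact: cvgM|exact: cvgMr].
Qed.

Lemma ccvgV u l : l != 0 -> ccvg u l -> ccvg (fun n => (u n)^-1) l^-1.
Proof.
move=> l0 ul; have Nl : 0 < N l by rewrite normc_gt0.
have Nl2 : 0 < N l / 2 by rewrite divr_gt0.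
apply: (ccvg_le (b := fun n => 2 / N l ^+ 2 * N (u n - l))); last first.
  by rewrite -(mulr0 (2 / N l ^+ 2)); exact: cvgMr.
near=> n; have h : N (u n - l) < N l / 2 by near: n; exact: ccvg_near.
have Nu : N l / 2 <= N (u n).
  have := normc_triangle l 0 (u n); rewrite !subr0 normc_distC.
  by move: h; lra.
have un0 : u n != 0 by rewrite -normc_gt0 (lt_le_trans Nl2).
rewrite (_ : (u n)^-1 - l^-1 = (l - u n) * ((u n)^-1 * l^-1)); last first.
  by field; apply/andP; split.
rewrite Normc.normcM normc_distC mulrC ler_wpM2r ?normc_ge0//.
rewrite Normc.normcM !Normc.normcV -invfM.
have -> : 2 / N l ^+ 2 = (N l / 2 * N l)^-1 by field; rewrite gt_eqF.
rewrite lef_pV2 ?posrE ?mulr_gt0 ?normc_gt0//.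
by rewrite ler_wpM2r ?(ltW Nl).
Unshelve. all: by end_near. Qed.

End ComplexSequences.

(** * Transport of Cauchy transforms under repeated differentiation *)

Section Characteristics.
Context {R : realType}.
Local Open Scope complex_scope.
Local Notation N := Normc.normc.

Lemma cauchy_avg (s : seq R) z :
  cauchy (avg s) z = ((size s)%:R^-1)%:C * log_deriv s z.
Proof.
apply: eqC; rewrite ?ReZ ?ImZ /= /avg; congr (_ * _).
  by rewrite Re_sum.
by rewrite Im_sum.
Qed.

Lemma cauchy_probability (mu : probability (measurableTypeR R) R) z :
  cauchy (fun f => \int[mu]_x f x) z = cauchy_transform mu z.
Proof. by []. Qed.

Lemma ccvg_cauchy (E : nat -> (R -> R) -> R) (E' : (R -> R) -> R) z :
  0 < complex.Im z ->
  (forall f, Cb f -> E n f @[n --> \oo] --> E' f) ->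
  ccvg (fun n => cauchy (E n) z) (cauchy E' z).
Proof. by move=> /CbC_resolvent[c1 c2] h; apply: ccvg_Re_Im; apply: h. Qed.

Variables (d k : nat -> nat) (p : nat -> {poly R})
  (mu : probability (measurableTypeR R) R) (t : R).
Hypotheses (hp : forall j, real_rooted_monic (d j) (p j))
  (hd : d j @[j --> \oo] --> \oo)
  (hmu : weak_cvg (fun j => root_measure (p j)) mu)
  (hk : forall j, (1 <= k j <= d j)%N)
  (ht : 0 < t < 1)
  (hkd : ((k j)%:R / (d j)%:R : R) @[j --> \oo] --> t).

Local Notation G := (cauchy_transform mu).
Let S j m := root_seq (monic_deriv (d j - m) (d j) (p j)).
Let M j := (d j - k j)%N.

Lemma size_deriv_roots j m : (m <= d j)%N -> size (S j m) = (d j - m)%N.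
Proof.
move=> md; have [_ [s [ss h]]] := monic_deriv_real_rooted md (hp j).
by rewrite (size_root_seq h).
Qed.

Lemma degree_cvgy (A : R) : \forall j \near \oo, A <= (d j)%:R.
Proof.
have := hd (nbhs_infty_ge (Num.truncn A).+1).
rewrite /nbhs/=; apply: filterS => j /= h.
by rewrite (le_trans (ltW (truncnS_gt A)))// ler_nat.
Qed.

Lemma initial_cauchy_cvg z : 0 < complex.Im z ->
  ccvg (fun j => cauchy (avg (S j 0%N)) z) (G z).
Proof.
move=> z0; apply: (ccvg_cauchy z0) => f cf.
have [cont _] := cf.
have := hmu cont (bounded_fun_Cb cf); rewrite (integral_Cb _ cf).
move=> /fine_cvg; apply: cvg_trans; apply: near_eq_cvg; apply: nearW => j /=.
have [_ [s [_ h]]] := monic_deriv_real_rooted (leq0n (d j)) (hp j).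
have e : monic_deriv (d j - 0) (d j) (p j) = p j.
  by rewrite /monic_deriv !subn0 subnn derivn0 big_geq// invr1 scale1r.
rewrite e in h; rewrite (integral_root_measure h) /S ?e//.
exact: continuous_measurable_fun.
Qed.

(** The Newton iterates end at a point zj that depends on j and only tends to zeta; the Lipschitz
    bound d / e^2 on the logarithmic derivative, harmless after division by d, moves the value to
    zeta itself. *)
Lemma characteristics_cvg z : 0 < complex.Im z -> G z != 0 ->
  let zeta := z - (1 - t)%:C * (G z)^-1 in 0 < complex.Im zeta ->
  ccvg (fun j => cauchy (avg (S j (M j))) zeta) ((t^-1)%:C * G z).
Proof.
move=> z0 G0 zeta zeta0.
have /andP[t0 t1] := ht.
pose g j := cauchy (avg (S j 0%N)) z.
have gG : ccvg g (G z) := initial_cauchy_cvg z0.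
pose a j : R := (M j)%:R / (d j)%:R.
have d0 j : (0 < d j)%N by have /andP[h1 h2] := hk j; exact: leq_trans h2.
have dR0 j : 0 < (d j)%:R :> R by rewrite ltr0n.
have acvg : a j @[j --> \oo] --> 1 - t.
  rewrite (_ : a = fun j => 1 - (k j)%:R / (d j)%:R).
    by apply: cvgB => //; exact: cvg_cst.
  apply/funext => j; rewrite /a /M natrB ?mulrBl ?divff ?gt_eqF//.
  by have /andP[] := hk j.
have zcvg : ccvg (fun j => z - (a j)%:C * (g j)^-1) zeta.
  apply: ccvgB; first exact: ccvg_cst.
  by apply: ccvgM; [exact: ccvg_real|exact: ccvgV].
have NG : 0 < N (G z) by rewrite normc_gt0.
(* Eventually |g j| >= |G z| / 2 = 2 c, the lower bound that [newton_iterates] expects. *)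
pose c := N (G z) / 4; have c0 : 0 < c by rewrite divr_gt0.
(* Height 2 e is needed at both ends of the line, and its far end is only within e of zeta. *)
pose e := Num.min (complex.Im z) (complex.Im zeta) / 4.
have e0 : 0 < e by rewrite divr_gt0// lt_min z0.
have ez : 4 * e <= complex.Im z by rewrite /e mulrC divfK// ge_min lexx.
have ezeta : 4 * e <= complex.Im zeta.
  by rewrite /e mulrC divfK// ge_min lexx orbT.
have cG : N (G z) = 4 * c by rewrite /c mulrC divfK.
clearbody c e.
pose K := (c ^+ 2 * e ^+ 3)^-1 + 2 * (c ^+ 3 * e ^+ 4)^-1.
have K0 : 0 < K.
  by rewrite addr_gt0 ?mulr_gt0 ?invr_gt0 ?mulr_gt0 ?exprn_gt0.
have g_log j : g j = ((d j)%:R^-1)%:C * log_deriv (S j 0%N) z.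
  by rewrite /g cauchy_avg size_deriv_roots ?subn0.
have dC0 j : ((d j)%:R : R)%:C != 0 by rewrite fmorph_eq0 gt_eqF.
have L0 j : log_deriv (S j 0%N) z = ((d j)%:R : R)%:C * g j.
  by rewrite g_log mulrA -rmorphM/= divff ?gt_eqF// mul1r.
have Mle j : (M j <= d j)%N by exact: leq_subr.
(* Normalized by the original degree, to be compared with g; the k j remaining roots bring in the
   factor d j / k j -> 1 / t at the end. *)
pose u j := ((d j)%:R^-1)%:C * log_deriv (S j (M j)) zeta.
have bound : \forall j \near \oo, N (u j - g j) <=
    (K + K / (c ^+ 2 * e ^+ 2)) / (d j)%:R +
    (e ^+ 2)^-1 * N (z - (a j)%:C * (g j)^-1 - zeta).
  near=> j.
  have Ng : N (g j - G z) < N (G z) / 2.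
    by near: j; apply: (ccvg_near gG); rewrite divr_gt0.
  have Ng2 : 2 * c <= N (g j).
    have := normc_triangle (G z) 0 (g j); rewrite !subr0 normc_distC.
    by move: Ng; rewrite cG; lra.
  have gj0 : g j != 0 by rewrite -normc_gt0 (lt_le_trans _ Ng2)// mulr_gt0.
  have eline : z - (M j)%:R * (log_deriv (S j 0%N) z)^-1 =
      z - (a j)%:C * (g j)^-1.
    congr (_ - _); rewrite L0 invfM mulrA; congr (_ * _).
    by rewrite /a rmorphM/= fmorphV/= !rmorph_nat.
  have Nline : N (z - (a j)%:C * (g j)^-1 - zeta) < e.
    by near: j; exact: (ccvg_near zcvg e0).
  have [zj [h1 h2 h3]] : exists zj, [/\ e <= complex.Im zj,
      N (log_deriv (S j (M j)) zj - log_deriv (S j 0%N) z) <= K &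
      N (zj - (z - (M j)%:R * (log_deriv (S j 0%N) z)^-1)) <=
        K / (c ^+ 2 * (d j)%:R)].
    apply: (newton_iterates c0 e0 (Mle j)).
    - by move=> m mM; rewrite size_deriv_roots ?leq_subr// (leq_trans mM).
    - move=> m w mM w0; apply: log_deriv_monic_deriv => //.
        exact: leq_trans (Mle j).
      by rewrite gt_eqF.
    - by rewrite L0 Normc.normcM normc_real ger0_norm// mulrA [leRHS]mulrC ler_wpM2r.
    - have e0' := e0; lra.
    - rewrite eline; have := normc_ge_normIm (z - (a j)%:C * (g j)^-1 - zeta).
      rewrite ImB ler_norml => /andP[+ _].
      have e0' := e0; move: Nline ezeta; lra.
    - rewrite [leRHS]mulrC -ler_pdivrMr//; near: j; exact: degree_cvgy.
    - rewrite [leRHS]mulrC -ler_pdivrMr//; near: j; exact: degree_cvgy.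
    - rewrite ler_pdivrMr ?mulr_gt0 ?exprn_gt0// [leRHS]mulrA -ler_pdivrMl.
        near: j; exact: degree_cvgy.
      by rewrite mulr_gt0// exprn_gt0.
  rewrite eline in h3.
  have -> : u j - g j = ((d j)%:R^-1)%:C *
     ((log_deriv (S j (M j)) zeta - log_deriv (S j (M j)) zj) +
      (log_deriv (S j (M j)) zj - log_deriv (S j 0%N) z)).
    by rewrite /u g_log; ring.
  rewrite Normc.normcM normc_real ger0_norm ?invr_ge0 ?ler0n//.
  rewrite mulrC ler_pdivrMr//.
  apply: le_trans (le_normcD _ _) _.
  have ezz : e <= complex.Im zeta by have e0' := e0; move: ezeta; lra.
  have sM : (size (S j (M j)) <= d j)%N.
    by rewrite size_deriv_roots ?leq_subr.
  have lip := log_deriv_lipschitz e0 h1 ezz sM.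
  have dist : N (zeta - zj) <=
      N (z - (a j)%:C * (g j)^-1 - zeta) + K / (c ^+ 2 * (d j)%:R).
    have := normc_triangle zj zeta (z - (a j)%:C * (g j)^-1).
    by rewrite (normc_distC zj zeta); move: h3; lra.
  apply: le_trans (lerD lip h2) _.
  have : (d j)%:R / e ^+ 2 * N (zeta - zj) <= (d j)%:R / e ^+ 2 *
    (N (z - (a j)%:C * (g j)^-1 - zeta) + K / (c ^+ 2 * (d j)%:R)).
    by rewrite ler_wpM2l// divr_ge0// sqr_ge0.
  move=> h; apply: (le_trans (lerD h (lexx K))).
  set X := N (_ - zeta); rewrite le_eqVlt; apply/orP; left; apply/eqP.
  by field; rewrite !gt_eqF.
have ucvg : ccvg u (G z).
  apply: (@ccvg_le _ _ _ (fun j =>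
    ((K + K / (c ^+ 2 * e ^+ 2)) / (d j)%:R +
    (e ^+ 2)^-1 * N (z - (a j)%:C * (g j)^-1 - zeta)) + N (g j - G z))).
    apply: filterS bound => j h; apply: le_trans (normc_triangle _ _ (g j)) _.
    by rewrite lerD2r.
  rewrite (_ : 0 = (K + K / (c ^+ 2 * e ^+ 2)) * 0 + (e ^+ 2)^-1 * 0 + 0); last first.
    by ring.
  apply: cvgD => //; apply: cvgD; last exact: cvgMr.
  apply: cvgMr; apply/cvgrPdist_le => r r0; near=> j.
  rewrite sub0r normrN ger0_norm ?invr_ge0 ?ler0n//.
  rewrite -[leRHS]invrK lef_pV2 ?posrE ?invr_gt0//.
  by near: j; exact: degree_cvgy.
rewrite (_ : (fun j => _) = (fun j => (((k j)%:R / (d j)%:R)^-1 : R)%:C * u j)).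
  apply: ccvgM => //; apply: ccvg_real; apply: cvgV => //.
  by rewrite gt_eqF.
apply/funext => j; rewrite cauchy_avg size_deriv_roots// /u mulrA -rmorphM/=.
have /andP[kj1 kjd] := hk j; rewrite /M subKn//; congr (_%:C * _).
have kR0 : 0 < (k j)%:R :> R by rewrite ltr0n.
by field; rewrite !gt_eqF.
Unshelve. all: by end_near. Qed.

End Characteristics.

(** * Free convolution powers *)

Section FreePowers.
Context {R : realType}.
Local Open Scope complex_scope.
Implicit Types (mu nu : probability (measurableTypeR R) R) (z : R[i]).
Local Notation N := Normc.normc.

Lemma Rintegral_Dil (c : R) nu (f : R -> R) : Cb f ->
  \int[Dil c nu]_x f x = \int[nu]_x f (c * x).
Proof.
move=> cf; rewrite /Rintegral; congr fine.
rewrite (integral_distribution (X := dilation c) (f := EFin \o f))//.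
  by apply/measurable_EFinP; apply: continuous_measurable_fun; have [] := cf.
by apply: (@integrable_Cb _ nu (fun x => f (c * x))); exact: Cb_comp.
Qed.

Lemma cauchy_Dil (c : R) nu z : 0 < c -> 0 < complex.Im z ->
  cauchy_transform (Dil c nu) z = (c^-1)%:C * cauchy_transform nu ((c^-1)%:C * z).
Proof.
move=> c0 z0; have cz0 : 0 < complex.Im ((c^-1)%:C * z).
  by rewrite ImZ mulr_gt0 ?invr_gt0.
have hM := mean_Rintegral nu.
rewrite -[RHS](cmeanZ hM); last exact: CbC_resolvent.
have [h1 h2] := CbC_resolvent z0.
have e x : resolvent z (c * x) = (c^-1)%:C * resolvent ((c^-1)%:C * z) x.
  have -> : (c^-1)%:C * resolvent ((c^-1)%:C * z) x =
      (c%:C * ((c^-1)%:C * z - x%:C))^-1 by rewrite invfM -fmorphV.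
  by rewrite mulrBr mulrA -!rmorphM/= mulfV ?gt_eqF// mul1r.
apply: eqC => /=.
  rewrite (Rintegral_Dil _ _ h1); congr Rintegral; apply/funext => x.
  by rewrite -e.
rewrite (Rintegral_Dil _ _ h2); congr Rintegral; apply/funext => x.
by rewrite -e.
Qed.

(* The subordination map: K_nu(w) = s K_mu(w) - (s - 1) / w evaluated at
   w = G_mu(z). *)
Definition subordination (s : R) mu z : R[i] :=
  z + (1 - s)%:C * ((cauchy_transform mu z)^-1 - z).

Lemma near_identity_subordination s mu : near_identity (subordination s mu).
Proof.
apply: near_identity_scale; apply: near_identity_recip_cauchy.
  exact: mean_Rintegral.
exact: tight_Rintegral.
Qed.

Lemma near_identity_cauchy mu : near_identity (fun z => (cauchy_transform mu z)^-1).
Proof.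
apply: near_identity_recip_cauchy; first exact: mean_Rintegral.
exact: tight_Rintegral.
Qed.

(** As the inverse of 0 is 0, a zero of G at z would put 1 / G at distance |z| from z, where |z| / 2
    is allowed. *)
Lemma cauchy_cone_neq0 mu (a : R) : 0 < a -> exists2 b, 0 < b &
  forall z, truncated_cone a b z -> cauchy_transform mu z != 0.
Proof.
move=> a0; have e0 : 0 < 2^-1 :> R by rewrite invr_gt0.
have [b b0 h] := near_identity_cauchy mu a0 e0.
exists b => // z cz; have [hz _] := h z z cz cz.
have [z0 _] := normc_cone (ltW b0) cz.
apply/eqP => Gz; move: hz; rewrite Gz invr0 sub0r normcN.
have : 0 < N z by rewrite normc_gt0 Im_gt0_neq0.
lra.
Qed.

Lemma cauchy_cone_inj mu (a : R) : 0 < a -> exists2 b, 0 < b &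
  forall b', b <= b' -> set_inj (truncated_cone a b') (cauchy_transform mu).
Proof.
move=> a0; have [b b0 h] := near_identity_inj (near_identity_cauchy mu) a0.
exists b => // b' /h hb z w cz cw e; apply: hb => //=.
by rewrite e.
Qed.

(** Frees the relation from partial inverses: at w = G_mu(z) one has K_mu(w) = z, and R_nu(w) = s
    R_mu(w) says that K_nu(w) is [subordination s mu z]. *)
Lemma is_free_conv_powerP (s : R) mu nu :
  is_free_conv_power s mu nu <->
  exists a b : R, [/\ 0 < a, 0 < b & forall z, truncated_cone a b z ->
    cauchy_transform nu (subordination s mu z) = cauchy_transform mu z].
Proof.
split.
  move=> [a [b [a0 b0 imu inu [a' [b' [a'0 b'0 h]]]]]].
  (* Strictly below a', since 1 / G_mu widens the aperture slightly. *)
  pose a1 := Num.min a a' / 2.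
  have m0 : 0 < Num.min a a' by rewrite lt_min a0.
  have a10 : 0 < a1 by rewrite divr_gt0.
  have a1a : a1 < Num.min a a' by rewrite ltr_pdivrMr// ltr_pMr// ltr1n.
  have a1a' : a1 < a' by rewrite (lt_le_trans a1a)// ge_min lexx orbT.
  have {}a1a : a1 <= a by rewrite ltW// (lt_le_trans a1a)// ge_min lexx.
  have [b1 b10 hF] := near_identity_maps (near_identity_cauchy mu) a10 a1a' b'0.
  exists a1, (Num.max b b1); split => //; first by rewrite lt_max b0.
  move=> z cz.
  have cz1 : truncated_cone a1 b1 z.
    by apply: truncated_coneS cz; rewrite ?lexx ?le_max ?lexx ?orbT// ltW.
  have cz2 : truncated_cone a b z.
    by apply: truncated_coneS cz; rewrite ?lexx ?le_max ?lexx ?orbT// ltW.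
  have [_ [z2 cz' e2]] := h _ (hF _ cz1).
  rewrite /R_transform /K_transform -{1}e2.
  rewrite pinvKV ?inE// pinvKV ?inE// => e.
  suff -> : subordination s mu z = z2 by [].
  move/(canRL (subrK _)): e => ->; rewrite /subordination.
  by rewrite rmorphB/= rmorph1; ring.
move=> [a [b [a0 b0 h]]].
(* Three nested apertures: each 1 / w of aperture a / 4 is 1 / G_mu(z) for some z of aperture a / 2,
   which the subordination map sends into aperture a. *)
have a2 : 0 < a / 2 by rewrite divr_gt0.
have a4 : 0 < a / 4 by rewrite divr_gt0.
have a24 : a / 4 < a / 2 by lra.
have a12 : a / 2 < a by lra.
have [b1 b10 i1] := cauchy_cone_inj mu a0.
have [b2 b20 i2] := cauchy_cone_inj nu a0.
have [b3 b30 n3] := cauchy_cone_neq0 mu a0.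
pose B := Num.max (Num.max b b1) (Num.max b2 b3).
have B0 : 0 < B by rewrite !lt_max b0.
have bB : b <= B by rewrite !le_max lexx.
have b1B : b1 <= B by rewrite !le_max lexx !orbT.
have b2B : b2 <= B by rewrite !le_max lexx !orbT.
have b3B : b3 <= B by rewrite !le_max lexx !orbT.
clearbody B.
have [b4 b40 hH] := near_identity_maps (near_identity_subordination s mu) a2 a12 B0.
pose B' := Num.max B b4.
have B'0 : 0 < B' by rewrite lt_max B0.
have [b5 b50 hS] := near_identity_surj (near_identity_cauchy mu) a4 a24 B'0.
exists a, B; split => //; [exact: i1|exact: i2|].
exists (a / 4), b5; split => // w /hS[z cz ez].
have czH : truncated_cone (a / 2) b4 z.
  by apply: truncated_coneS cz; rewrite ?lexx ?le_max ?lexx ?orbT// ltW.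
have czB : truncated_cone a B z.
  by apply: truncated_coneS cz; rewrite ?(ltW a12) ?le_max ?lexx ?orbT// ltW.
have Gw : cauchy_transform mu z = w by apply: invr_inj.
have Gw' : cauchy_transform nu (subordination s mu z) = w.
  by rewrite h//; apply: truncated_coneS czB; rewrite ?lexx// ltW.
have cH := hH _ czH.
split; [by exists z|by exists (subordination s mu z)|].
rewrite /R_transform /K_transform -{1}Gw' pinvKV ?inE//; last exact: i2.
rewrite -{2}Gw pinvKV ?inE//; last exact: i1.
rewrite /subordination Gw rmorphB/= rmorph1; ring.
Qed.

(** The subordination map depends on mu alone and its image covers a half-line of the imaginary
    axis, where both Cauchy transforms are therefore equal. *)
Lemma is_free_conv_power_unique (s : R) mu nu nu' (f : R -> R) :
  is_free_conv_power s mu nu -> is_free_conv_power s mu nu' -> Cb f ->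
  \int[nu]_x f x = \int[nu']_x f x.
Proof.
move=> /is_free_conv_powerP[a [b [a0 b0 h]]].
move=> /is_free_conv_powerP[a' [b' [a'0 b'0 h']]] cf.
pose a1 := Num.min a a'; have a10 : 0 < a1 by rewrite lt_min a0.
pose b1 := Num.max b b'; have b10 : 0 < b1 by rewrite lt_max b0.
have a20 : 0 < a1 / 2 by rewrite divr_gt0.
have a21 : a1 / 2 < a1 by lra.
have [b2 b20 hS] :=
  near_identity_surj (near_identity_subordination s mu) a20 a21 b10.
apply: (mean_eq_cauchy (mean_Rintegral nu) (mean_Rintegral nu')
  (@tight_Rintegral _ nu) (@tight_Rintegral _ nu') b20) => // y yb.
have cy : truncated_cone (a1 / 2) b2 (0 +i* y).
  split=> //=; rewrite normr0 mulr_gt0//; exact: lt_trans yb.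
have [z cz <-] := hS _ cy.
have cz1 : truncated_cone a b z.
  by apply: truncated_coneS cz; rewrite ?ge_min ?le_max ?lexx ?orbT// ltW.
have cz2 : truncated_cone a' b' z.
  by apply: truncated_coneS cz; rewrite ?ge_min ?le_max ?lexx ?orbT// ltW.
by rewrite [LHS]h// [RHS]h'.
Qed.

Lemma mean_tail E (y : R) : mean E -> 0 < y ->
  E (tail y) = 1 - complex.Re ((0 +i* y) * cauchy E (0 +i* y)).
Proof.
move=> hE y0; have [_ h2] := @CbC_resolvent R (0 +i* y) y0.
rewrite ReM /= mul0r sub0r opprK -(meanZ hE)// -{1}(mean_cst hE 1).
rewrite -(meanD hE); [|exact: Cb_cst|exact: CbZ].
congr E; apply/funext => x /=.
have ? : x ^+ 2 + y ^+ 2 != 0.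
  by rewrite gt_eqF// ltr_wpDl ?sqr_ge0// exprn_gt0.
by rewrite /tail !subr0 sub0r sqrrN; field.
Qed.

End FreePowers.

(** * Tightness and identification of the limit *)

Section DerivativesLimit.
Context {R : realType}.
Local Open Scope complex_scope.
Local Notation N := Normc.normc.
Variables (mu : probability (measurableTypeR R) R) (t : R)
  (E : nat -> (R -> R) -> R).
Hypotheses (t0 : 0 < t) (hE : forall j, mean (E j))
  (cvgE : forall z, 0 < complex.Im z -> cauchy_transform mu z != 0 ->
     let zeta := z - (1 - t)%:C * (cauchy_transform mu z)^-1 in
     0 < complex.Im zeta ->
     ccvg (fun j => cauchy (E j) zeta) ((t^-1)%:C * cauchy_transform mu z)).

Local Notation G := (cauchy_transform mu).
Local Notation H := (subordination t^-1 mu).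

Lemma scaled_subordination z :
  t%:C * H z = z - (1 - t)%:C * (G z)^-1.
Proof.
rewrite /subordination mulrDr mulrA -rmorphM/= (_ : t * (1 - t^-1) = t - 1).
  by rewrite !rmorphB/= rmorph1; ring.
by field; rewrite gt_eqF.
Qed.

Lemma cauchy_cvg_cone : exists2 b, 0 < b & forall z, truncated_cone 1 b z ->
  0 < complex.Im (t%:C * H z) /\
  ccvg (fun j => cauchy (E j) (t%:C * H z)) ((t^-1)%:C * G z).
Proof.
have a12 : (1 : R) < 2 by rewrite ltr1n.
have [b b0 n0] := @cauchy_cone_neq0 R mu 1 ltr01.
have [b' b'0 hH] := near_identity_maps (near_identity_subordination t^-1 mu)
  ltr01 a12 (@ltr01 R).
exists (Num.max b b'); first by rewrite lt_max b0.
move=> z cz.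
have cz1 : truncated_cone 1 b z.
  by apply: truncated_coneS cz; rewrite ?lexx ?le_max ?lexx ?orbT// ltW.
have cz2 : truncated_cone 1 b' z.
  by apply: truncated_coneS cz; rewrite ?lexx ?le_max ?lexx ?orbT// ltW.
have [z0 _] := normc_cone (ltW b0) cz1.
have [H0 _] := normc_cone ler01 (hH _ cz2).
have tH0 : 0 < complex.Im (t%:C * H z) by rewrite ImZ mulr_gt0.
split=> //; rewrite scaled_subordination in tH0 *.
by apply: cvgE => //; exact: n0.
Qed.

(** By [mean_tail] it suffices that i y times the limiting transform at i y be close to 1. With i y
    = t H(z) this product is H(z) G_mu(z), and both H(z) / z and z G_mu(z) are close to 1. *)
Lemma derivatives_tight : asymptotically_tight E.
Proof.
move=> e e0.
pose d := Num.min 1 (e / 8).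
have d0 : 0 < d by rewrite lt_min ltr01 divr_gt0.
have d1 : d <= 1 by rewrite ge_min lexx.
have d8 : d <= e / 8 by rewrite ge_min lexx orbT.
have [b b0 hb] := cauchy_cvg_cone.
have [b1 b10 h1] :=
  cauchy_asymptotics (mean_Rintegral mu) (@tight_Rintegral _ mu) (@ltr01 R) d0.
have [b2 b20 h2] := near_identity_subordination t^-1 mu (@ltr01 R) d0.
pose B := Num.max b (Num.max b1 b2).
have B0 : 0 < B by rewrite lt_max b0.
have h12 : 2^-1 < 1 :> R by rewrite invf_lt1// ltr1n.
have h02 : 0 < 2^-1 :> R by rewrite invr_gt0.
have [b3 b30 hS] := near_identity_surj (near_identity_subordination t^-1 mu)
  h02 h12 B0.
pose y := t * (b3 + 1).
have y0 : 0 < y by rewrite mulr_gt0// addr_gt0.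
exists y => //.
have cv : truncated_cone 2^-1 b3 (0 +i* (b3 + 1)).
  split=> /=; last by rewrite ltrDl.
  by rewrite normr0 mulr_gt0// addr_gt0.
have [z cz Hz] := hS _ cv.
have sub b' : b' <= B -> 0 <= b' -> truncated_cone 1 b' z.
  by move=> ? ?; apply: truncated_coneS cz; rewrite ?lexx// ltW.
have cz0 : truncated_cone 1 b z by apply: sub; rewrite ?le_max ?lexx// ltW.
have cz1 : truncated_cone 1 b1 z by apply: sub; rewrite ?le_max ?lexx ?orbT// ltW.
have cz2 : truncated_cone 1 b2 z by apply: sub; rewrite ?le_max ?lexx ?orbT// ltW.
have [_ cv1] := hb _ cz0.
have [k1 _] := h1 _ _ cz1 cz1; have [k2 _] := h2 _ _ cz2 cz2.
rewrite Hz in cv1 k2.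
have ty : t%:C * (0 +i* (b3 + 1)) = 0 +i* y.
  by apply: eqC; rewrite ?ReZ ?ImZ/= ?mulr0.
rewrite ty in cv1.
have {}cv1 := ccvgM (ccvg_cst (0 +i* y)) cv1.
(* 2 d from H(z) / z, multiplied by |z G z| <= 2, and d from z G z. One more d for the limit in j
   gives 4 d <= e / 2. *)
have lim_close : N ((0 +i* y) * ((t^-1)%:C * G z) - 1) <= 3 * d.
  have -> : (0 +i* y) * ((t^-1)%:C * G z) =
      (0 +i* (b3 + 1)) * G z.
    rewrite -ty mulrACA -rmorphM/= mulfV ?gt_eqF// mul1r//.
  have [z0 _] := normc_cone (ltW b0) cz0.
  have zn0 := Im_gt0_neq0 z0.
  set v := 0 +i* (b3 + 1) in k2 *.
  have -> : v * G z - 1 = (v - z) * z^-1 * (z * G z) + (z * G z - 1).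
    by field.
  apply: le_trans (le_normcD _ _) _.
  have hz : N (z * G z) <= 2.
    have := normc_triangle (z * G z) 0 1; rewrite !subr0 Normc.normc1.
    by move: k1 d1; rewrite /= cauchy_probability; lra.
  have hv : N ((v - z) * z^-1) <= d.
    by rewrite Normc.normcM Normc.normcV ler_pdivrMr// normc_gt0.
  rewrite Normc.normcM.
  have := ler_pM (normc_ge0 _) (normc_ge0 _) hv hz.
  by move: k1; rewrite cauchy_probability; lra.
near=> j.
have hj : N ((0 +i* y) * cauchy (E j) (0 +i* y) -
    (0 +i* y) * ((t^-1)%:C * G z)) < d.
  by near: j; exact: (ccvg_near cv1 d0).
rewrite (mean_tail (hE j) y0).
set w := _ * cauchy _ _ in hj *.
set X := _ * (_ * G z) in lim_close hj.
have := normc_triangle 1 w X; rewrite (normc_distC 1 X) (normc_distC X w) => tri.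
have := le_trans (ler_norm _) (normc_ge_normRe (1 - w)).
rewrite ReB (_ : complex.Re 1 = 1)//.
by move: tri hj lim_close d8 e0; lra.
Unshelve. all: by end_near. Qed.

Lemma derivatives_cvg (f : R -> R) : Cb f ->
  E j f @[j --> \oo] --> \int[Dil t (free_conv_power t^-1 mu)]_x f x.
Proof.
have [b b0 hb] := cauchy_cvg_cone.
have h12 : 2^-1 < 1 :> R by rewrite invf_lt1// ltr1n.
have h02 : 0 < 2^-1 :> R by rewrite invr_gt0.
have [b1 b10 hS] := near_identity_surj (near_identity_subordination t^-1 mu)
  h02 h12 b0.
have cvgCb : forall f, Cb f -> cvgn (E ^~ f).
  (* Heights are scaled by t, since the transforms converge at t H(z). *)
  apply: (@means_cvg _ E (t * b1)) => //; first exact: derivatives_tight.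
    by rewrite mulr_gt0.
  move=> y yb.
  have cy : truncated_cone 2^-1 b1 (0 +i* (y / t)).
    have yt : b1 < y / t by rewrite ltr_pdivlMr// mulrC.
    by split=> //=; rewrite normr0 mulr_gt0// (lt_trans b10).
  have [z cz Hz] := hS _ cy.
  have [|_] := hb z; first by apply: truncated_coneS cz; rewrite ?lexx// ltW.
  rewrite Hz (_ : t%:C * _ = 0 +i* y); last first.
    by apply: eqC; rewrite ?ReZ ?ImZ/= ?mulr0// mulrC divfK// gt_eqF.
  by move=> h; split; apply: cvgP; [exact: ccvg_Re h|exact: ccvg_Im h].
have hL := mean_lim hE cvgCb.
have tL := tight_lim hE derivatives_tight cvgCb.
pose nu := mean_measure hL tL.
have Enu g : Cb g -> E j g @[j --> \oo] --> \int[nu]_x g x.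
  by move=> cg; rewrite -(mean_representation hL tL cg); exact: cvgCb.
have ti0 : 0 < t^-1 by rewrite invr_gt0.
(* Undoing the dilation of the limit exhibits a convolution power, so the choice behind
   [free_conv_power] is not the default. *)
have fcp : is_free_conv_power t^-1 mu (Dil t^-1 nu).
  apply/is_free_conv_powerP; exists 1, b; split => // z cz.
  have [H0 lim1] := hb z cz.
  have lim2 := ccvg_cauchy H0 Enu.
  have H0' : 0 < complex.Im (H z) by move: H0; rewrite ImZ pmulr_rgt0.
  rewrite cauchy_Dil// invrK -cauchy_probability (ccvg_unique lim2 lim1).
  by rewrite mulrA -rmorphM/= mulfV ?gt_eqF// mul1r.
have fcp' : is_free_conv_power t^-1 mu (free_conv_power t^-1 mu).
  by rewrite /free_conv_power; case: xgetP => [nu' -> //|/(_ (Dil t^-1 nu))].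
move=> cf; have cft := Cb_comp t cf.
rewrite Rintegral_Dil// -(is_free_conv_power_unique fcp fcp' cft) Rintegral_Dil//.
rewrite (_ : (fun x => f _) = f); first exact: Enu.
by apply/funext => x; rewrite mulrA mulfV ?gt_eqF// mul1r.
Qed.

End DerivativesLimit.

Theorem theorem7p6 (R : realType) (d k : nat -> nat) (p : nat -> {poly R})
    (mu : probability (measurableTypeR R) R) (t : R)
    (hp : forall j, real_rooted_monic (d j) (p j))
    (hd : d j @[j --> \oo] --> \oo)
    (hmu : weak_cvg (fun j => root_measure (p j)) mu)
    (hk : forall j, (1 <= k j <= d j)%N)
    (ht : 0 < t < 1)
    (hkd : ((k j)%:R / (d j)%:R : R) @[j --> \oo] --> t) :
  weak_cvg (fun j => root_measure (monic_deriv (k j) (d j) (p j)))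
           (Dil t (free_conv_power t^-1 mu)).
Proof.
have /andP[t0 _] := ht.
(* The characteristics count derivatives taken, the statement counts the remaining degree. *)
have kd j : (d j - (d j - k j))%N = k j.
  by rewrite subKn//; have /andP[] := hk j.
have splits j : size (root_seq (monic_deriv (k j) (d j) (p j))) = k j /\
    exists s, monic_deriv (k j) (d j) (p j) = (\prod_(r <- s) ('X - r%:P)).
  have [_ [s [ss h]]] := monic_deriv_real_rooted (leq_subr (k j) (d j)) (hp j).
  by rewrite kd in ss h; rewrite (size_root_seq h); split=> //; exists s.
pose E j := avg (root_seq (monic_deriv (k j) (d j) (p j))).
have hE j : mean (E j).
  by apply: mean_avg; have [-> _] := splits j; have /andP[] := hk j.
have cvgE z : 0 < complex.Im z -> cauchy_transform mu z != 0 ->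
    let zeta := z - (1 - t)%:C%C * (cauchy_transform mu z)^-1 in
    0 < complex.Im zeta ->
    ccvg (fun j => cauchy (E j) zeta) ((t^-1)%:C%C * cauchy_transform mu z).
  move=> z0 G0 zeta zeta0.
  have := characteristics_cvg hp hd hmu hk ht hkd z0 G0 zeta0.
  by under [X in ccvg X]funext do rewrite kd.
move=> f cf bf; have Cf := Cb_bounded_fun cf bf.
rewrite (integral_Cb _ Cf).
rewrite (_ : (fun j => _) = (fun j => (E j f)%:E)).
  apply/cvg_EFin; first exact: nearW.
  exact: (derivatives_cvg t0 hE cvgE Cf).
apply/funext => j; have [_ [s h]] := splits j.
rewrite (integral_root_measure h)//.
exact: continuous_measurable_fun.
Qed.
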